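(* There exists a measure-preserving flow on a standard probability space that is almost mixing but not mixing.
   Context: A flow $(T_t)_{t\in\mathbb{R}}$ is a (jointly measurable) measure-preserving action of $\mathbb{R}$ on a standard probability space $(X,\mu)$. We write $(T_uf)(x)=f(T_ux)$ for functions $f$ on $X$, and $(\cdot,\cdot)$ for the inner product in $L_2(\mu)$. The flow is mixing if for every $f,g\in L_2(\mu)$, $(T_uf,g)\to \int_X f\,d\mu\int_X \overline{g}\,d\mu$ as $u\to\infty$. An ergodic flow is called almost mixing if for every continuous (i.e. atomless) Borel probability measure $\nu$ on $\mathbb{R}$ and every $f\in L_1(X,\mu)$, $$\left\|\int_{\mathbb{R}} f(T_{rt}x)\, d\nu(r) -\int_X f \, d\mu\right\|_{L_1(\mu)}\to 0\quad\text{as } t\to +\infty .$$ *)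

(* Defs.v *)
From HB Require Import structures.
From mathcomp Require Import all_boot all_order all_algebra.
From mathcomp Require Import complex.
From mathcomp Require Import all_classical all_reals all_analysis.

Set Implicit Arguments.
Unset Strict Implicit.
Unset Printing Implicit Defensive.

Import Order.TTheory GRing.Theory Num.Theory.
Import numFieldNormedType.Exports.
Import ComplexField.

Local Open Scope classical_set_scope.
Local Open Scope ring_scope.

(* The sigma-algebra is the Borel one of some separable complete metric space
   on the same set of points (up to a bijection [h]). *)
Definition standard_borel (R : realType) d (X : measurableType d) : Prop :=
  exists (Y : metricType R) (h : X -> Y),
    [/\ forall F : set_system Y, ProperFilter F -> cauchy F ->
          exists y : Y, F --> y,
        exists2 D : set Y, countable D & dense D,
        bijective h
      & @measurable d X = [set h @^-1` B | B in <<s @open Y >>]].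

Section complex_functions.
Context d (X : measurableType d) (R : realType).
Variable mu : {measure set X -> \bar R}.

Definition Lpnorm (p : \bar R) (f : X -> R[i]) : \bar R :=
  'N[mu]_p[EFin \o (@Normc.normc R \o f)]%E.

(* Borel representatives of the elements of the complex space L_p(mu). *)
Definition in_Lp (p : \bar R) (f : X -> R[i]) : Prop :=
  [/\ measurable_fun setT (fun x => complex.Re (f x)),
      measurable_fun setT (fun x => complex.Im (f x))
    & (Lpnorm p f < +oo)%E].

Definition cintegral (f : X -> R[i]) : R[i] :=
  Complex (\int[mu]_x complex.Re (f x)) (\int[mu]_x complex.Im (f x)).

Definition inner (f g : X -> R[i]) : R[i] :=
  cintegral (fun x => f x * conjc (g x)).

End complex_functions.

Section flows.
Context d (X : measurableType d) (R : realType).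
Variables (mu : probability X R) (T : R -> X -> X).

Record mp_flow : Prop := MpFlow {
  flow0 : forall x, T 0 x = x ;
  flowD : forall s t x, T (s + t) x = T s (T t x) ;
  flow_measurable : measurable_fun [set: measurableTypeR R * X]
    (fun z : measurableTypeR R * X => T z.1 z.2) ;
  flow_preserving : forall t (A : set X), measurable A ->
    mu (T t @^-1` A) = mu A }.

Definition ergodic : Prop :=
  forall A : set X, measurable A ->
    (forall t, mu ((T t @^-1` A) `+` A) = 0%E) ->
    mu A = 0%E \/ mu A = 1%E.

(* [R[i]^o] carries the usual topology of the complex numbers. *)
Definition mixing : Prop :=
  forall f g : X -> R[i], in_Lp mu 2%:E f -> in_Lp mu 2%:E g ->
    (inner mu (fun x => f (T u x)) g : R[i]^o) @[u --> +oo] -->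
      (cintegral mu f * cintegral mu (fun x => conjc (g x)) : R[i]^o).

Definition almost_mixing : Prop :=
  ergodic /\
  forall nu : probability (measurableTypeR R) R,
    (forall r : R, nu [set r] = 0%E) ->
    forall f : X -> R[i], in_Lp mu 1 f ->
      Lpnorm mu 1 (fun x => cintegral nu (fun r => f (T (r * t) x))
                            - cintegral mu f) @[t --> +oo] --> 0%E.

End flows.

(* Main.v *)
Require Import Defs.
From HB Require Import structures.
From mathcomp Require Import all_boot all_order all_algebra.
From mathcomp Require Import complex.
From mathcomp Require Import all_classical all_reals all_analysis.
From mathcomp Require Import measurable_realfun.
From mathcomp Require Import ring lra zify.

Set Implicit Arguments.
Unset Strict Implicit.
Unset Printing Implicit Defensive.

Import Order.TTheory GRing.Theory Num.Theory.
Import numFieldNormedType.Exports.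

Local Open Scope classical_set_scope.
Local Open Scope ring_scope.

(** The flow is the translation flow of a stationary random closed set: the
    Poisson suspension of an infinite measure preserving flow. Put
    a_n = (n + 2) (n + 2)!, which exceeds a_0 + ... + a_(n-1) by the factor n + 2,
    and throw at random on the line infinite clusters of the form
    x + {all sums of distinct a_k}. The set obtained misses a bounded set U of
    times with probability exp (- dens U), where dens U is the limit of 2^-n
    times the length of the union of the translates of U by the 2^n sums of
    distinct numbers among a_0, ..., a_(n-1).

    Non-mixing: for an interval U of length 1, dens U = 1 and the translates of U
    and of U + a_n by sums of the first n + 1 gaps overlap in half of their
    length, so dens (U `|` (U + a_n)) is at most 3/2, where independence would
    give 2 ([dens_recurrence]).

    Almost mixing: if t is large and not close to some a_n, at the scale of a_n,
    then t is not near a difference of two sums of gaps, so the translates of U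
    are disjoint from those of U + t, dens is additive on them, and the events
    that U and that U + t are missed are exactly independent ([dens_indep]). The
    exceptional times form a set B that is thin: for an atomless nu, the nu x nu measure of
    the pairs (r, r') with (r - r') t in B tends to 0, because within a fixed
    multiplicative range of t at most one a_n is felt, and besides a
    neighbourhood of 0 it only excludes differences r - r' in one short interval
    and its opposite ([thin_recurrent]). Expanding the square, the average of the indicator of
    such an event along T_(r t), with r drawn from nu, is close in L2 to its mean
    ([averaging_indep]). The events that some finite union of balls is missed
    are stable under intersection and generate, so the conclusion passes to all
    events ([averaging_generated]) and, by density, to L1
    ([averaging_integrable]). Ergodicity is the case where nu is uniform.

    Existence of the random set: exp (- dens) is completely monotone, because
    the opposite of dens is, up to a constant, a limit of lengths of complements,
    and complete monotonicity survives products, sums and limits, hence exponentials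
    ([cm_avoid]). Inclusion-exclusion then gives nonnegative probabilities to all
    patterns of missed and hit rational balls, and nested intervals realise
    them on the unit interval with Lebesgue measure
    ([unit_prob_void_events]).

    The random set is carried by the function of x that is the distance from x
    to it, cut at 1. The state space is therefore the space of 1-Lipschitz
    functions from the line to [0, 1]: it is a complete separable metric space
    on which translations act everywhere, without exceptional points, and
    jointly measurably. A ball of radius s <= 1 around x is missed exactly when
    the function is at least s at x. *)

(** * Completely monotone functions of finite families *)

Section complete_monotonicity.
Context {R : realType} {E : Type}.
Implicit Types (g h : seq E -> R) (U : seq E) (x : bool * E).

(** If g is the probability that all sets of a family are missed, this adds to
    the event the requirement that the set x.2 be missed (x.1 = true) or hit
    (x.1 = false). *)
Definition diffop x g U : R :=
  if x.1 then g (x.2 :: U) else g U - g (x.2 :: U).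

Fixpoint nabla (l : seq (bool * E)) g : seq E -> R :=
  if l is x :: l' then nabla l' (diffop x g) else g.

(** Every inclusion-exclusion sum that ought to be the probability of a pattern
    of missed and hit sets is nonnegative. Families are sequences, and no
    compatibility with permutations or repetitions has to be assumed. *)
Definition completely_monotone g := forall l U, 0 <= nabla l g U.

Lemma nablaD l g h U :
  nabla l (fun V => g V + h V) U = nabla l g U + nabla l h U.
Proof.
elim: l g h => [//|[b e] l IHl] g h /=; rewrite -IHl; congr (nabla l _ U).
by apply/funext => V; rewrite /diffop /=; case: b => //; ring.
Qed.

Lemma cm_diffop x g : completely_monotone g -> completely_monotone (diffop x g).
Proof. by move=> cmg l; apply: (cmg (x :: l)). Qed.

Lemma cmD g h : completely_monotone g -> completely_monotone h -> completely_monotone (fun U => g U + h U).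
Proof. by move=> cmg cmh l U; rewrite nablaD addr_ge0. Qed.

Lemma cm_cst (c : R) : 0 <= c -> completely_monotone (fun=> c).
Proof.
move=> + l; elim: l c => [|[b e] l IHl] c c0 U //=.
by case: b; rewrite /diffop/=; [exact: IHl|rewrite subrr; exact: IHl].
Qed.

(** Leibniz rule: the step along e of a product g h is
    (step of g) h + g (e :: .) (step of h), a sum of products of completely
    monotone functions with one letter less to process. *)
Lemma cmM g h : completely_monotone g -> completely_monotone h -> completely_monotone (fun U => g U * h U).
Proof.
move=> + + l; elim: l g h => [|x l IHl] g h cmg cmh U /=.
  by rewrite mulr_ge0//; [exact: (cmg [::])|exact: (cmh [::])].
case: x => -[] e.
  exact: (IHl _ _ (cm_diffop (true, e) cmg) (cm_diffop (true, e) cmh)).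
pose g1 := diffop (true, e) g; pose dg := diffop (false, e) g.
pose dh := diffop (false, e) h.
rewrite (_ : diffop _ _ = fun V => dg V * h V + g1 V * dh V); last first.
  by apply/funext => V; rewrite /dg /dh /g1 /diffop/=; ring.
rewrite nablaD addr_ge0//; apply: IHl => //; exact: cm_diffop.
Qed.

Lemma cmX g n : completely_monotone g -> completely_monotone (fun U => g U ^+ n).
Proof.
move=> cmg; elim: n => [|n IHn]; first exact: cm_cst.
rewrite (_ : (fun U => _) = fun U => g U * g U ^+ n); first exact: cmM.
by apply/funext => U; rewrite exprS.
Qed.

Lemma cm_sum (G : nat -> seq E -> R) n :
  (forall k, completely_monotone (G k)) -> completely_monotone (fun U => \sum_(0 <= k < n) G k U).
Proof.
move=> cmG; elim: n => [|n IHn].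
  rewrite (_ : (fun U => _) = fun=> 0); first exact: cm_cst.
  by apply/funext => U; rewrite big_geq.
rewrite (_ : (fun U => _) = fun U => \sum_(0 <= k < n) G k U + G n U).
  exact: cmD.
by apply/funext => U; rewrite big_nat_recr.
Qed.

Lemma cvg_nabla l (G : nat -> seq E -> R) g :
  (forall U, G ^~ U @ \oo --> g U) ->
  forall U, (fun n => nabla l (G n) U) @ \oo --> nabla l g U.
Proof.
elim: l G g => [//|[b e] l IHl] G g Gg U /=.
apply: IHl => V; rewrite /diffop/=; case: b => //; exact: cvgB.
Qed.

Lemma cm_lim (G : nat -> seq E -> R) g :
  (forall U, G ^~ U @ \oo --> g U) -> (forall n, completely_monotone (G n)) -> completely_monotone g.
Proof.
move=> Gg cmG l U; have Gl := @cvg_nabla l G g Gg U.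
rewrite -(cvg_lim _ Gl)//; apply: limr_ge; first by apply/cvg_ex; eexists; exact: Gl.
by apply: nearW => n; exact: cmG.
Qed.

(** The exponential series has nonnegative coefficients. *)
Lemma cm_expR g : completely_monotone g -> completely_monotone (fun U => expR (g U)).
Proof.
move=> cmg; apply: (@cm_lim (fun n U => series (exp_coeff (g U)) n)).
  by move=> U; exact: is_cvg_series_exp_coeff.
move=> n; rewrite /series/=; apply: cm_sum => k.
rewrite /exp_coeff/=; apply: cmM; first exact: cmX.
by apply: cm_cst; rewrite invr_ge0.
Qed.

End complete_monotonicity.

(** * Patterns as nested intervals *)

Section nested_intervals.
Context {R : realType} {E : Type}.
Variables (v : seq E -> R) (B : nat -> E).
Hypotheses (v_cm : completely_monotone v) (v_nil : v [::] = 1).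
Implicit Types (w : seq bool) (u : R) (S : pred nat) (n : nat).

(** Words are written with the most recent letter first, so that the set
    concerned by a letter is given by the length of the word that follows it. *)
Fixpoint letters w : seq (bool * E) :=
  if w is b :: w' then (b, B (size w')) :: letters w' else [::].

Definition wprob w : R := nabla (letters w) v [::].

Lemma wprob_nil : wprob [::] = 1.
Proof. exact: v_nil. Qed.

Lemma wprob_ge0 w : 0 <= wprob w.
Proof. exact: v_cm. Qed.

Lemma wprob_split w : wprob (true :: w) + wprob (false :: w) = wprob w.
Proof.
rewrite /wprob/= -nablaD; congr (nabla _ _ _).
by apply/funext => V; rewrite /diffop/=; ring.
Qed.

(** The left end of the interval attached to a word. This interval has length
    [wprob w] and is cut in two by the next letter, false on the left. *)
Fixpoint wleft w : R :=
  if w is b :: w' then wleft w' + (if b then wprob (false :: w') else 0) else 0.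

Definition next_bit w u : bool := wleft w + wprob (false :: w) <= u.

Fixpoint word n u : seq bool :=
  if n is m.+1 then next_bit (word m u) u :: word m u else [::].

Definition bit n u := next_bit (word n u) u.

Lemma size_word n u : size (word n u) = n.
Proof. by elim: n => //= n ->. Qed.

(** The first letters read from u are w exactly on the interval attached to w,
    because the intervals of the two extensions of a word partition its own. *)
Lemma wordP w u : 0 <= u < 1 ->
  (word (size w) u == w) = (wleft w <= u < wleft w + wprob w).
Proof.
move=> u01; elim: w => [|b w IHw] /=.
  by rewrite wprob_nil add0r u01 eqxx.
rewrite eqseq_cons.
have := wprob_split w; have := wprob_ge0 (true :: w).
have := wprob_ge0 (false :: w).
move=> p0 p1 pE.
rewrite /next_bit; case: (eqVneq (word (size w) u) w) IHw => [->|_] /=.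
  move/esym/andP => [uw1 uw2].
  case: b; rewrite ?eqb_id ?eqbF_neg andbT.
    by apply/idP/andP => [h|[]//]; split=> //; lra.
  by rewrite -ltNge; apply/idP/andP => [h|[]//]; [split|]; lra.
move/esym/negbT; rewrite andbF negb_and => uw; apply/esym/negbTE/negP => /andP[].
by case/orP: uw; rewrite -?ltNge -?leNgt => uw; case: b; lra.
Qed.
End nested_intervals.

(** * Events with prescribed void probabilities *)

Section unit_interval.
Context {R : realType}.

Let mU : measurable (`[0%R, 1%R[%classic : set (measurableTypeR R)).
Proof. exact: measurable_itv. Qed.

Definition unit_prob : set (measurableTypeR R) -> \bar R :=
  mrestr (@lebesgue_measure R) mU.

HB.instance Definition _ := Measure.on unit_prob.

Let unit_probT : unit_prob setT = 1%E.
Proof.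
by rewrite /unit_prob /mrestr setTI lebesgue_measure_itv/= lte_fin ltr01 sube0.
Qed.

HB.instance Definition _ := Measure_isProbability.Build _ _ R unit_prob unit_probT.

Lemma unit_prob_itv (a b : R) (A : set R) : 0 <= a -> a <= b -> b <= 1 ->
  (forall u, 0 <= u < 1 -> A u <-> a <= u < b) -> unit_prob A = (b - a)%:E.
Proof.
move=> a0 ab b1 AE; rewrite /unit_prob /mrestr.
rewrite (_ : A `&` _ = `[a, b[%classic).
  rewrite lebesgue_measure_itv/= lte_fin; case: ltP => //.
  by move=> ba; rewrite (_ : a = b) ?subrr//; apply/eqP; rewrite eq_le ab ba.
apply/seteqP; split=> u /=; rewrite !in_itv/=.
  by move=> [Au u01]; apply/(AE _ u01).
by move=> /andP[au ub]; rewrite AE; [split=> //|]; apply/andP; split; lra.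
Qed.

End unit_interval.

Section void_events.
Context {R : realType} {E : Type}.
Variables (v : seq E -> R) (B : nat -> E).
Hypotheses (v_cm : completely_monotone v) (v_nil : v [::] = 1).
Implicit Types (w : seq bool) (u : R) (S : pred nat) (n : nat).

Local Notation word := (word v B).
Local Notation wprob := (wprob v B).
Local Notation wleft := (wleft v B).
Local Notation next_bit := (next_bit v B).

Lemma measurable_word n w : measurable ([set u | word n u == w] : set (measurableTypeR R)).
Proof.
elim: n w => [|n IHn] [|b w] /=.
- by rewrite (_ : [set _ | _] = setT); [exact: measurableT|by apply/seteqP; split=> u /=].
- by rewrite (_ : [set _ | _] = set0); [exact: measurable0|by apply/seteqP; split=> u /=].
- by rewrite (_ : [set _ | _] = set0); [exact: measurable0|by apply/seteqP; split=> u /=].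
rewrite (_ : [set _ | _] = [set u | word n u == w] `&`
   (if b then [set u | next_bit w u] else ~` [set u | next_bit w u])).
  have mb : measurable ([set u | next_bit w u] : set (measurableTypeR R)).
    rewrite (_ : [set u | _] = `[wleft w + wprob (false :: w), +oo[%classic).
      exact: measurable_itv.
    by apply/seteqP; split => u /=; rewrite in_itv/= andbT.
  by apply: measurableI; [exact: IHn|case: b => //; exact: measurableC].
apply/seteqP; split => u /=; rewrite eqseq_cons -/word.
  move=> /andP[/eqP nb /eqP wu]; rewrite -wu; split => //; move: nb; case: b => [//|/negbT/negP].
  exact.
by move=> [/eqP wu]; rewrite wu; case: b => /=; rewrite /next_bit;
   [move=> ->|move=> /negP/negbTE ->]; rewrite !eqxx.
Qed.

Definition void_event n : set (measurableTypeR R) := [set u | bit v B n u].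

Lemma measurable_void_event n : measurable (void_event n).
Proof.
rewrite (_ : void_event n = \bigcup_w [set u | word n.+1 u == true :: w]).
  by apply: countable_bigcupT_measurable => [|w]; [exact: countableP|exact: measurable_word].
apply/seteqP; split => u /=.
  by rewrite /void_event/= => bu; exists (word n u) => //=; apply/eqP; congr cons.
by move=> [w _] /=; rewrite eqseq_cons => /andP[/eqP].
Qed.

Lemma wleft_bounds w : 0 <= wleft w /\ wleft w + wprob w <= 1.
Proof.
elim: w => [|b w [IH0 IH1]] /=; first by rewrite (wprob_nil B v_nil) add0r.
have := wprob_split v B w; have := wprob_ge0 B v_cm (true :: w).
have := wprob_ge0 B v_cm (false :: w).
by rewrite -/wprob -/wleft; case: b; lra.
Qed.

Lemma unit_prob_word w :
  unit_prob [set u | word (size w) u == w] = (wprob w)%:E.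
Proof.
have [w0 w1] := wleft_bounds w; have p0 := wprob_ge0 B v_cm w.
rewrite (@unit_prob_itv _ (wleft w) (wleft w + wprob w))//.
- by rewrite addrAC subrr add0r.
- by rewrite lerDl.
- by move=> u u01; rewrite /= (wordP _ v_cm v_nil).
Qed.

Fixpoint ok S w : bool :=
  if w is b :: w' then (S (size w') ==> b) && ok S w' else true.

Fixpoint words n : seq (seq bool) :=
  if n is m.+1 then [seq true :: w | w <- words m] ++ [seq false :: w | w <- words m]
  else [:: [::]].

Lemma mem_words n w : (w \in words n) = (size w == n).
Proof.
elim: n w => [|n IHn] [|b w] //=.
  by rewrite mem_cat; apply/negbTE/negP => /orP[] /mapP[].
rewrite mem_cat eqSS -IHn; apply/orP/idP => [[] /mapP[w' w'n [_ ->]]//|wn].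
by case: b; [left|right]; apply/mapP; exists w.
Qed.

Lemma uniq_words n : uniq (words n).
Proof.
elim: n => //= n IHn; rewrite cat_uniq !map_inj_uniq ?IHn ?andbT//=.
- by apply/hasPn => _ /mapP[w _ ->]; apply/negP => /mapP[].
- by move=> ? ? [].
- by move=> ? ? [].
Qed.

(** The order, latest index first, is the one in which the letters of a word
    are processed. *)
Fixpoint chosen S n : seq E :=
  if n is m.+1 then (if S m then B m :: chosen S m else chosen S m) else [::].

(** A letter that is not prescribed contributes both of its values, and the two
    steps add up to the identity; only the prescribed letters remain. *)
Lemma sum_ok_nabla S n (g : seq E -> R) U :
  \sum_(w <- words n | ok S w) nabla (letters B w) g U = g (chosen S n ++ U).
Proof.
elim: n g U => [|n IHn] g U /=; first by rewrite big_cons big_nil/= addr0.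
rewrite big_cat/= !big_map/= addrC.
have -> : \sum_(w <- words n | ok S (true :: w)) nabla (letters B (true :: w)) g U
   = g (B n :: chosen S n ++ U).
  transitivity (\sum_(w <- words n | ok S w)
      nabla (letters B w) (diffop (true, B n) g) U); last by rewrite IHn.
  rewrite big_seq_cond [RHS]big_seq_cond; apply: eq_big => w /=.
    by rewrite implybT.
  by rewrite mem_words => /andP[/eqP-> _].
have [Sn|Sn] := boolP (S n).
  rewrite big_seq_cond big_pred0 ?add0r// => w /=.
  by rewrite mem_words; case: eqP => //= ->; rewrite Sn.
have -> : \sum_(w <- words n | ok S (false :: w)) nabla (letters B (false :: w)) g U
   = g (chosen S n ++ U) - g (B n :: chosen S n ++ U).
  transitivity (\sum_(w <- words n | ok S w)
      nabla (letters B w) (diffop (false, B n) g) U); last by rewrite IHn.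
  rewrite big_seq_cond [RHS]big_seq_cond; apply: eq_big => w /=.
    by rewrite mem_words; case: eqP => //= ->; rewrite implybF (negbTE Sn).
  by rewrite mem_words => /andP[/eqP-> _].
by rewrite subrK.
Qed.

Lemma unit_prob_words n (s : seq (seq bool)) : uniq s ->
  {in s, forall w, size w = n} ->
  unit_prob [set u | word n u \in s] = (\sum_(w <- s) wprob w)%:E.
Proof.
elim: s => [|w s IHs] /=; first by rewrite big_nil => _ _;
  rewrite (_ : [set _ | _] = set0) ?measure0//; apply/seteqP; split => u.
move=> /andP[ws us] sn; rewrite big_cons EFinD -IHs//; last first.
  by move=> x xs; apply: sn; rewrite inE xs orbT.
have wn : size w = n by apply: sn; rewrite mem_head.
rewrite -unit_prob_word wn -measureU.
- by congr unit_prob; apply/seteqP; split => u /=; rewrite inE => /orP.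
- exact: measurable_word.
- rewrite (_ : [set _ | _] = \bigcup_(x in [set` s]) [set u | word n u == x]).
    by apply: fin_bigcup_measurable => // x _; exact: measurable_word.
  apply/seteqP; split => u /=; first by exists (word n u) => /=.
  by move=> [x xs /eqP->].
- by apply/seteqP; split => // u /= [/eqP->]; rewrite (negbTE ws).
Qed.

Lemma ok_word S n u : ok S (word n u) <-> forall k, (k < n)%N -> S k -> bit v B k u.
Proof.
elim: n => [|n IHn]; first by split.
rewrite [word _ _]/= [ok _ _]/= size_word; split.
  move=> /andP[/implyP nb /IHn okn] k; rewrite ltnS leq_eqVlt => /orP[/eqP->|]//.
  exact: okn.
move=> h; apply/andP; split; first by apply/implyP => Sn; exact: (h n).
by apply/IHn => k kn; apply: h; exact: ltnW.
Qed.

(** Kolmogorov's extension theorem in the form needed here: a completely monotone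
    v is the void functional of a sequence of events on the unit interval. *)
Lemma unit_prob_void_events S n :
  unit_prob [set u | forall k, (k < n)%N -> S k -> void_event k u] =
  (v (chosen S n))%:E.
Proof.
rewrite (_ : [set _ | _] = [set u | word n u \in [seq w <- words n | ok S w]]).
  rewrite (@unit_prob_words n) ?filter_uniq ?uniq_words//.
    by rewrite big_filter (sum_ok_nabla S n v [::]) cats0.
  by move=> w; rewrite mem_filter mem_words => /andP[_ /eqP].
apply/seteqP; split => u /=; rewrite mem_filter mem_words size_word eqxx andbT.
  by move=> h; apply/ok_word.
by move=> /ok_word.
Qed.

End void_events.

(** * Saturation of a set of times by sums of gaps *)

Section translates.
Context {R : realType}.
Implicit Types (a t : R) (U V A B : set (measurableTypeR R)).
Notation lam := (@lebesgue_measure R).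

Definition translate a U : set (measurableTypeR R) := [set x | U (x + a)].

Let add a : measurableTypeR R -> measurableTypeR R := fun x => x + a.

Let measurable_add a : measurable_fun [set: measurableTypeR R] (add a).
Proof. exact: measurable_funD. Qed.

Lemma measurable_shift a U : measurable U -> measurable (translate a U).
Proof. by move=> mU; rewrite -[translate a U]setTI; exact: measurable_add. Qed.

Lemma lebesgue_shift a U : measurable U -> lam (translate a U) = lam U.
Proof.
move=> mU; rewrite -[LHS]/(pushforward lam (add a) U).
apply/esym/lebesgue_measure_unique => //= _ [[x y]] _ <-.
rewrite /pushforward (_ : add a @^-1` _ = `]x - a, y - a]%classic).
  by rewrite !lebesgue_measure_itv/= !lte_fin ltrD2r -!EFinB opprB addrA subrK.
by apply/seteqP; split => z /=; rewrite !in_itv/= /add ltrBlDr lerBrDr.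
Qed.

Lemma shiftU a A B : translate a (A `|` B) = translate a A `|` translate a B.
Proof. by []. Qed.

Lemma shift_shift a t A : translate a (translate t A) = translate (a + t) A.
Proof. by apply/funext => x; rewrite /translate/= addrA. Qed.

Lemma shift0 A : translate 0 A = A.
Proof. by apply/funext => x; rewrite /translate/= addr0. Qed.

(** The factor n + 2 makes each gap much larger than the sum of the previous
    ones, see [gapE]; the second factor makes that sum telescope. *)
Definition gap n : R := (n.+2 * n.+2`!)%:R.

(** The sum of the gaps of index less than n, see [gapspanS]. *)
Definition gapspan n : R := n.+2`!%:R - 2.

Lemma gapspanS n : gapspan n.+1 = gapspan n + gap n.
Proof. by rewrite /gapspan /gap [n.+3`!]factS mulSnr natrD; ring. Qed.

Lemma gapspan_ge0 n : 0 <= gapspan n.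
Proof. by rewrite subr_ge0 ler_nat; elim: n => // n; rewrite [n.+3`!]factS; lia. Qed.

Lemma gapE n : gap n = n.+2%:R * (gapspan n + 2).
Proof. by rewrite /gap /gapspan subrK natrM. Qed.

Lemma gap_gt n : gapspan n + 1 < gap n.
Proof.
rewrite gapE -addn2 natrD; have := gapspan_ge0 n; have : 0 <= n%:R :> R by [].
by nra.
Qed.

(** The times from which some sum of distinct gaps of index less than n leads
    into U, see [satP]. *)
Fixpoint sat n U : set (measurableTypeR R) :=
  if n is m.+1 then sat m U `|` translate (gap m) (sat m U) else U.

Lemma measurable_sat n U : measurable U -> measurable (sat n U).
Proof.
by move=> mU; elim: n => //= n IH; apply: measurableU => //; exact: measurable_shift.
Qed.

Lemma satU n A B : sat n (A `|` B) = sat n A `|` sat n B.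
Proof. by elim: n => //= n ->; rewrite shiftU setUACA. Qed.

Lemma satS n A B : A `<=` B -> sat n A `<=` sat n B.
Proof. by move=> AB; elim: n => //= n IH; apply: setUSS => // x; exact: IH. Qed.

Lemma sat_shift n a A : sat n (translate a A) = translate a (sat n A).
Proof.
by elim: n => //= n ->; rewrite shiftU !shift_shift addrC.
Qed.

Definition finm U := measurable U /\ (lam U < +oo)%E.

Lemma finmU A B : finm A -> finm B -> finm (A `|` B).
Proof.
move=> [mA fA] [mB fB]; split; first exact: measurableU.
by apply: le_lt_trans (measureU2 _ mA mB) _; rewrite lte_add_pinfty.
Qed.

Lemma finm_shift a A : finm A -> finm (translate a A).
Proof. by move=> [mA fA]; split; [exact: measurable_shift|rewrite lebesgue_shift]. Qed.

Lemma finm_sat n U : finm U -> finm (sat n U).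
Proof. by move=> fU; elim: n => //= n IH; apply: finmU => //; exact: finm_shift. Qed.

Lemma finmS A B : measurable A -> A `<=` B -> finm B -> finm A.
Proof.
move=> mA AB [mB fB]; split=> //; apply: le_lt_trans fB.
by apply: le_measure; rewrite ?inE.
Qed.

Lemma finmE U : finm U -> (fine (lam U))%:E = lam U.
Proof. by move=> [mU fU]; rewrite fineK// ge0_fin_numE. Qed.

Definition len U : R := fine (lam U).

Lemma len_ge0 U : 0 <= len U. Proof. exact: fine_ge0. Qed.

Lemma len_shift a U : measurable U -> len (translate a U) = len U.
Proof. by move=> mU; rewrite /len lebesgue_shift. Qed.

Lemma le_len A B : measurable A -> finm B -> A `<=` B -> len A <= len B.
Proof.
move=> mA fB AB; rewrite -lee_fin !finmE//; last exact: finmS AB fB.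
by case: fB => mB _; apply: le_measure; rewrite ?inE.
Qed.

Lemma lenU A B : finm A -> finm B -> A `&` B = set0 ->
  len (A `|` B) = len A + len B.
Proof.
move=> fA fB AB0; apply: EFin_inj; rewrite EFinD !finmE//; last exact: finmU.
by apply: measureU => //; [case: fA|case: fB].
Qed.

Lemma len_leU A B : finm A -> finm B -> len (A `|` B) <= len A + len B.
Proof.
move=> fA fB; rewrite -lee_fin EFinD !finmE//; last exact: finmU.
by apply: measureU2 => //; [case: fA|case: fB].
Qed.

Lemma lenD A B : finm A -> measurable B ->
  len (A `\` B) = len A - len (A `&` B).
Proof.
move=> fA mB; have [mA _] := fA.
have fI : finm (A `&` B) by apply: finmS fA => //; exact: measurableI.
have fD : finm (A `\` B) by apply: finmS fA; [exact: measurableD|exact: subDsetl].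
have ID0 : (A `&` B) `&` (A `\` B) = set0.
  by apply/seteqP; split => // x [[_ Bx] [_ /(_ Bx)]].
by have := lenU fI fD ID0; rewrite setUIDK; lra.
Qed.

(** The normalisation counts the 2 ^ n sums of gaps, so this is at most the
    length of U, with equality as long as the translates do not overlap. *)
Definition sdens n U : R := len (sat n U) / 2 ^+ n.

Lemma sdens_ge0 n U : 0 <= sdens n U.
Proof. by rewrite divr_ge0 ?len_ge0// exprn_ge0. Qed.

Lemma sdensS n U : finm U -> sdens n.+1 U <= sdens n U.
Proof.
move=> fU; rewrite /sdens ler_pdivrMr ?exprn_gt0// exprS mulrCA divfK ?expf_neq0//.
have fS := finm_sat n fU; have [mS _] := fS.
apply: le_trans (len_leU fS (finm_shift (gap n) fS)) _.
by rewrite len_shift//; lra.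
Qed.

Lemma sdens0 U : sdens 0 U = len U.
Proof. by rewrite /sdens/= expr0 divr1. Qed.

Lemma sdens_nonincreasing U : finm U -> {homo sdens ^~ U : m n / (m <= n)%N >-> m >= n}.
Proof. by move=> fU; apply/nonincreasing_seqP => n; exact: sdensS. Qed.

Lemma sdens_le_len n U : finm U -> sdens n U <= len U.
Proof. by move=> fU; rewrite -sdens0; exact: sdens_nonincreasing. Qed.

Lemma le_sdens n A B : measurable A -> finm B -> A `<=` B -> sdens n A <= sdens n B.
Proof.
move=> mA fB AB; rewrite ler_pM2r ?invr_gt0 ?exprn_gt0//.
by apply: le_len; [exact: measurable_sat|exact: finm_sat|exact: satS].
Qed.

Lemma sdens_leU n A B : finm A -> finm B -> sdens n (A `|` B) <= sdens n A + sdens n B.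
Proof.
move=> fA fB; rewrite -mulrDl ler_pM2r ?invr_gt0 ?exprn_gt0// satU.
by apply: len_leU; exact: finm_sat.
Qed.

Lemma sdensU n A B : finm A -> finm B -> sat n A `&` sat n B = set0 ->
  sdens n (A `|` B) = sdens n A + sdens n B.
Proof. by move=> fA fB AB0; rewrite -mulrDl /sdens satU lenU//; exact: finm_sat. Qed.

Lemma sdens_shift n a A : measurable A -> sdens n (translate a A) = sdens n A.
Proof. by move=> mA; rewrite /sdens sat_shift len_shift//; exact: measurable_sat. Qed.

(** The measure, in an infinite measure preserving flow, of the set of points
    whose orbit meets the base during U. It is a nonincreasing limit of
    subadditive and translation invariant functions of U, and inherits these
    properties; additivity only holds for sets with disjoint saturations. *)
Definition dens U : R := limn (sdens ^~ U).

Lemma cvg_sdens U : finm U -> sdens ^~ U @ \oo --> dens U.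
Proof.
move=> fU; apply: nonincreasing_is_cvgn; first exact: sdens_nonincreasing.
by exists 0 => _ [n _ <-]; exact: sdens_ge0.
Qed.

Lemma dens_le_sdens n U : finm U -> dens U <= sdens n U.
Proof.
move=> fU; apply: nonincreasing_cvgn_ge; first exact: sdens_nonincreasing.
by apply/cvg_ex; exists (dens U); exact: cvg_sdens.
Qed.

Lemma dens_ge0 U : finm U -> 0 <= dens U.
Proof.
move=> fU; apply: limr_ge; first by apply/cvg_ex; exists (dens U); exact: cvg_sdens.
by apply: nearW => n; exact: sdens_ge0.
Qed.

Lemma le_dens A B : measurable A -> finm B -> A `<=` B -> dens A <= dens B.
Proof.
move=> mA fB AB; have fA := finmS mA AB fB.
by apply: ler_cvg_to (cvg_sdens fA) (cvg_sdens fB) _; apply: nearW => n; exact: le_sdens.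
Qed.

(** This domination by length is the continuity of [dens]. *)
Lemma dens_le_lenD A B : finm A -> finm B -> dens (A `|` B) <= dens A + len B.
Proof.
move=> fA fB; apply: ler_cvg_to (cvg_sdens (finmU fA fB)) _ _.
  by apply: cvgD; [exact: cvg_sdens fA|exact: cvg_cst].
apply: nearW => n; apply: le_trans (sdens_leU n fA fB) _.
by rewrite lerD2l sdens_le_len.
Qed.

Lemma dens_shift a A : measurable A -> dens (translate a A) = dens A.
Proof.
by move=> mA; congr (limn _); apply/funext => n; exact: sdens_shift.
Qed.

Lemma densU A B : finm A -> finm B -> (forall n, sat n A `&` sat n B = set0) ->
  dens (A `|` B) = dens A + dens B.
Proof.
move=> fA fB AB0; apply/(cvg_lim (@Rhausdorff R)).
rewrite (_ : sdens ^~ _ = sdens ^~ A \+ sdens ^~ B).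
  by apply: cvgD; exact: cvg_sdens.
by apply/funext => n /=; exact: sdensU.
Qed.

End translates.

(** * Times of independence and times of recurrence *)

Section recurrence_times.
Context {R : realType}.
Implicit Types (a t x s K : R) (A B : set (measurableTypeR R)).
Notation lam := (@lebesgue_measure R).

(** s is a sum of distinct gaps of index less than n. *)
Fixpoint gapsum n s : Prop :=
  if n is m.+1 then gapsum m s \/ gapsum m (s - gap m) else s = 0.

Lemma satP n (U : set (measurableTypeR R)) x : sat n U x -> exists2 s, gapsum n s & U (x + s).
Proof.
elim: n x => [|n IHn] x /=; first by exists 0; rewrite ?addr0.
case=> [/IHn[s ns Us]|/IHn[s ns Us]]; first by exists s => //; left.
by exists (gap n + s); [right; rewrite addrAC subrr add0r|rewrite addrA].
Qed.

Lemma gapsum_bound n s : gapsum n s -> 0 <= s <= gapspan n.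
Proof.
elim: n s => [|n IHn] s /=; first by move=> ->; rewrite lexx gapspan_ge0.
rewrite gapspanS; have := @gap_gt R n; have := @gapspan_ge0 R n => s0 g0.
by case=> /IHn/andP[h1 h2]; apply/andP; split; lra.
Qed.

(** A nonzero difference of sums of gaps is dominated by the last gap that is
    used in only one of the two sums. *)
Lemma gapsumB n s t : gapsum n s -> gapsum n t ->
  s = t \/ exists m, `| `|s - t| - gap m| <= gapspan m.
Proof.
elim: n s t => [|n IHn] s t /=; first by move=> -> ->; left.
have g0 := @gap_gt R n; have s0 := @gapspan_ge0 R n.
case=> ns [] nt.
- exact: IHn.
- right; exists n; have /andP[s1 s2] := gapsum_bound ns.
  have /andP[t1 t2] := gapsum_bound nt.
  by rewrite (@ler0_norm _ (s - t)) ?ler_norml; [apply/andP; split|]; lra.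
- right; exists n; have /andP[s1 s2] := gapsum_bound ns.
  have /andP[t1 t2] := gapsum_bound nt.
  by rewrite (@ger0_norm _ (s - t)) ?ler_norml; [apply/andP; split|]; lra.
- have [st|[m]] := IHn _ _ ns nt; first by left; lra.
  by rewrite opprB addrA subrK; right; exists m.
Qed.

(** The second alternative allows a deviation from [gap m] of the order of the
    previous gaps, negligible compared with [gap m] itself. *)
Definition recurrent K t : Prop :=
  `|t| <= K \/ exists m, `| `|t| - gap m| <= gapspan m + K.

(** A common point of the two saturations would put t within 2 K of a difference
    of two sums of gaps. *)
Lemma dens_indep K t A B : finm A -> finm B ->
  (forall x, A x -> `|x| <= K) -> (forall x, B x -> `|x| <= K) ->
  ~ recurrent (K + K) t -> dens (A `|` translate t B) = dens A + dens B.
Proof.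
move=> fA fB AK BK nt; have [mB _] := fB.
rewrite densU//; [by rewrite dens_shift|exact: finm_shift|].
move=> n; apply/seteqP; split=> // x [/satP[s ns /AK xs] /satP[s' ns' /BK xs']].
apply: nt; have : `|t - (s - s')| <= K + K.
  rewrite (_ : t - (s - s') = (x + s' + t) - (x + s)); last by ring.
  by apply: le_trans (ler_normB _ _) _; exact: lerD.
move=> tss; have [ss|[m sm]] := gapsumB ns ns'.
  by left; move: tss; rewrite ss subrr subr0.
right; exists m.
rewrite (_ : `|t| - gap m = (`|s - s'| - gap m) + (`|t| - `|s - s'|)); last by ring.
apply: le_trans (ler_normD _ _) _; apply: lerD => //.
by apply: le_trans (ler_dist_dist _ _) _.
Qed.

(** Its diameter 1 is smaller than the distance between distinct sums of gaps,
    so that its translates are disjoint and its density is its length. *)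
Definition unit_ball : set (measurableTypeR R) := ball (0:R) 2^-1.

Lemma finm_ball (x r : R) : finm (ball x r : set (measurableTypeR R)).
Proof.
split; first exact: measurable_ball.
have [r0|r0] := leP 0 r; first by rewrite lebesgue_measure_ball ?ltry.
by rewrite (ball0 _ _).2 ?measure0// ltW.
Qed.

Lemma len_unit_ball : len unit_ball = 1.
Proof.
by rewrite /len lebesgue_measure_ball ?invr_ge0//= mulr2n; lra.
Qed.

Lemma len_sat_unit_ball n : len (sat n unit_ball) = 2 ^+ n.
Proof.
elim: n => [|n IHn]; first by rewrite expr0 /= len_unit_ball.
have fS := finm_sat n (finm_ball 0 2^-1).
rewrite /= lenU ?len_shift ?IHn; [by rewrite exprS; lra|by case: fS|by []|exact: finm_shift|].
apply/seteqP; split=> // x [/satP[s ns xs] /satP[s' ns' xs']].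
have /andP[s1 s2] := gapsum_bound ns; have /andP[t1 t2] := gapsum_bound ns'.
have g0 := @gap_gt R n.
move: xs xs'; rewrite /unit_ball /ball/= !sub0r !normrN !ltr_norml.
by move=> /andP[? ?] /andP[? ?]; lra.
Qed.

Lemma dens_unit_ball : dens unit_ball = 1.
Proof.
apply/(cvg_lim (@Rhausdorff R)); apply: cvg_near_cst; apply: nearW => n.
by rewrite /sdens len_sat_unit_ball divff// expf_neq0.
Qed.

(** Let S be the saturation of the ball by the n first gaps. With one more gap the
    ball and its translate saturate to S, S + gap n and S - gap n together:
    three copies instead of four. *)
Lemma dens_recurrence n :
  dens (unit_ball `|` translate (- gap n) unit_ball) <= 3 / 2.
Proof.
have fb := finm_ball 0 2^-1; have fS := finm_sat n fb.
have fu : finm (unit_ball `|` translate (- gap n) unit_ball).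
  by apply: finmU => //; exact: finm_shift.
apply: le_trans (dens_le_sdens n.+1 fu) _.
rewrite /sdens ler_pdivrMr ?exprn_gt0//= satU sat_shift shiftU shift_shift.
rewrite subrr shift0; set S := sat n unit_ball.
rewrite (_ : _ `|` _ `|` _ = S `|` translate (- gap n) S `|` translate (gap n) S); last first.
  by apply/seteqP; split => x; rewrite /setU/=; tauto.
apply: le_trans (len_leU _ (finm_shift _ fS)) _; first exact: finmU (finm_shift _ fS).
rewrite len_shift; last by case: fS.
have := len_leU fS (finm_shift (- gap n) fS); rewrite len_shift; last by case: fS.
by rewrite len_sat_unit_ball exprS; lra.
Qed.

Fixpoint balls (l : seq (R * R)) : set (measurableTypeR R) :=
  if l is e :: l' then ball e.1 e.2 `|` balls l' else set0.

Lemma ballsP l y : balls l y <-> exists2 e, e \in l & ball e.1 e.2 y.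
Proof.
elim: l => [|e l IHl] /=; first by split => // -[].
split=> [[ey|/IHl[e' e'l e'y]]|[e']].
- by exists e => //; rewrite mem_head.
- by exists e' => //; rewrite inE e'l orbT.
- by rewrite inE => /predU1P[->|e'l e'y]; [left|right; apply/IHl; exists e'].
Qed.

Lemma finm_balls l : finm (balls l).
Proof.
elim: l => [|e l IHl] /=; first by split; [exact: measurable0|rewrite measure0 ltry].
by apply: finmU => //; exact: finm_ball.
Qed.

Lemma balls_bounded l : exists2 K, 0 <= K & forall x, balls l x -> `|x| <= K.
Proof.
elim: l => [|e l [K K0 IHl]] /=; first by exists 0.
exists (Num.max K (`|e.1| + `|e.2|)) => [|x]; first by rewrite le_max K0.
case=> [|/IHl xK]; last by rewrite le_max xK.
rewrite /ball/= => ex; rewrite le_max; apply/orP; right.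
rewrite (_ : x = e.1 - (e.1 - x)); last by ring.
apply: le_trans (ler_normB _ _) _; rewrite lerD2l ltW//.
by apply: lt_le_trans ex _; exact: ler_norm.
Qed.

Lemma balls_cat l l' : balls (l ++ l') = balls l `|` balls l'.
Proof. by elim: l => [|e l IHl] /=; rewrite ?set0U// IHl setUA. Qed.

Lemma balls_shift t l :
  balls [seq (e.1 + t, e.2) | e <- l] = translate (- t) (balls l).
Proof.
apply/seteqP; split => x; rewrite /translate/= !ballsP.
  move=> [_ /mapP[e el ->]] /=; rewrite /ball/= => ex; exists e => //.
  by have -> : e.1 - (x - t) = e.1 + t - x :> R by ring.
move=> [e el]; rewrite /ball/= => ex; exists (e.1 + t, e.2).
  by apply/mapP; exists e.
by rewrite /ball/=; have -> : e.1 + t - x = e.1 - (x - t) :> R by ring.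
Qed.

(** The probability that the random set misses all the balls of l. *)
Definition avoid (l : seq (R * R)) : R := expR (- dens (balls l)).

(** Requiring that e be missed or hit amounts to replacing S by the part of S
    outside or inside the saturation of e. *)
Lemma cm_len_setD n S : finm S -> completely_monotone (fun l => len (S `\` sat n (balls l)) / 2 ^+ n).
Proof.
move=> + l; elim: l S => [|[b e] l IHl] S fS U /=.
  by rewrite divr_ge0 ?len_ge0// exprn_ge0.
have mb := measurable_sat n (finm_ball e.1 e.2).1.
have mS : measurable S by case: fS.
have msU V := measurable_sat n (finm_balls V).1.
case: b; rewrite /diffop/=.
  rewrite (_ : (fun V => _) = fun V =>
    len ((S `\` sat n (ball e.1 e.2)) `\` sat n (balls V)) / 2 ^+ n).
    by apply: IHl; apply: finmS fS; [exact: measurableD|exact: subDsetl].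
  by apply/funext => V; rewrite satU setDDl.
rewrite (_ : (fun V => _) = fun V =>
    len ((S `&` sat n (ball e.1 e.2)) `\` sat n (balls V)) / 2 ^+ n).
  by apply: IHl; apply: finmS fS; [exact: measurableI|exact: subIsetl].
apply/funext => V; rewrite satU -mulrBl; congr (_ / _).
set C := sat n (ball _ _); set D := sat n (balls V).
have mD : measurable D := msU V.
have fSD : finm (S `\` D) by apply: finmS fS; [exact: measurableD|exact: subDsetl].
rewrite setUC -setDDl (lenD fSD mb) -/C opprB addrC subrK; congr len.
by rewrite setIDAC setIDA.
Qed.

(** For a window W, the function exp (- m (W `&` A)) of A is the product of the constant
    exp (- m (W)) and of exp (m (W \ A)). The windows exhaust the line because the
    families of balls are not confined to any of them. *)
Lemma cm_avoid : completely_monotone avoid.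
Proof.
apply: (@cm_lim _ _ (fun n l => expR (- sdens n (balls l)))) => [l|n].
  apply: continuous_cvg; first exact: continuous_expR.
  by apply: cvgN; exact: cvg_sdens (finm_balls l).
pose W (j : nat) : set (measurableTypeR R) := `[- j%:R, j%:R]%classic.
have fW j : finm (W j).
  split; first exact: measurable_itv.
  by rewrite lebesgue_measure_itv/=; case: ifP => _; rewrite ?ltry// -EFinB ltry.
apply: (@cm_lim _ _ (fun j l => expR (- (len (W j `&` sat n (balls l)) / 2 ^+ n)))).
  move=> l; apply: continuous_cvg; first exact: continuous_expR.
  apply: cvgN; apply: cvgMl => //.
  have fs := finm_sat n (finm_balls l).
  rewrite /len -[X in fine X]finmE//; apply: fine_cvg.
  rewrite (finmE fs).
  have sE : sat n (balls l) = \bigcup_j (W j `&` sat n (balls l)).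
    apply/seteqP; split => x; last by move=> [j _ []].
    move=> sx; have [j xj] : exists j, (`|x| < j%:R).
      by exists (Num.bound `|x|); apply: archi_boundP.
    exists j => //; split => //; rewrite /W/= in_itv/=.
    by move: xj; rewrite ltr_norml => /andP[? ?]; apply/andP; split; exact: ltW.
  have mI j : measurable (W j `&` sat n (balls l)).
    by apply: measurableI; [exact: measurable_itv|case: fs].
  rewrite [X in _ --> lam X]sE.
  apply: nondecreasing_cvg_mu => //; first exact: bigcup_measurable.
  move=> i j ij; apply/subsetPset => x []; rewrite /W/= !in_itv/= => /andP[xi ix] sx.
  have : (i%:R <= j%:R :> R) by rewrite ler_nat.
  by split=> //; apply/andP; split; lra.
move=> j; rewrite (_ : (fun l => _) = fun l =>
   expR (- (len (W j) / 2 ^+ n)) * expR (len (W j `\` sat n (balls l)) / 2 ^+ n)).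
  apply: cmM; first by apply: cm_cst; exact: expR_ge0.
  exact/cm_expR/cm_len_setD.
apply/funext => l; rewrite -expRD lenD//; last by case: (finm_sat n (finm_balls l)).
by congr expR; ring.
Qed.

Lemma avoid_nil : avoid [::] = 1.
Proof.
have f0 : finm (set0 : set (measurableTypeR R)) := finm_balls [::].
have d0 : dens (set0 : set (measurableTypeR R)) <= 0.
  by apply: le_trans (dens_le_sdens 0 f0) _; rewrite sdens0 /len measure0.
rewrite /avoid/= (_ : dens _ = 0) ?oppr0 ?expR0//.
by apply/eqP; rewrite eq_le d0 dens_ge0.
Qed.

End recurrence_times.

(** * The space of 1-Lipschitz functions to the unit interval *)

Section path_space.
Context {R : realType}.

Record lip1 := Lip1 {
  lip1_fun :> R -> R ;
  lip1_itv : forall x, 0 <= lip1_fun x <= 1 ;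
  lip1_lip : forall x y, `|lip1_fun x - lip1_fun y| <= `|x - y| }.

HB.instance Definition _ := gen_eqMixin lip1.
HB.instance Definition _ := gen_choiceMixin lip1.

Let cst0_itv (x : R) : 0 <= (0 : R) <= 1. Proof. by rewrite lexx ler01. Qed.

Let cst0_lip (x y : R) : `|0 - 0 : R| <= `|x - y|. Proof. by rewrite subrr normr0. Qed.

Definition lip1_cst0 := Lip1 cst0_itv cst0_lip.

HB.instance Definition _ := isPointed.Build lip1 lip1_cst0.

Lemma lip1_eq (f g : lip1) : f =1 g -> f = g.
Proof.
case: f g => [f f1 f2] [g g1 g2] /= /funext fg; subst g.
by congr Lip1; exact: Prop_irrelevance.
Qed.

(** Rationals of large rank hardly count in the distance, which therefore
    metrises pointwise convergence. *)
Definition weight (q : rat) : R := (choice.pickle q).+1%:R.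

Lemma weight_gt0 q : 0 < weight q. Proof. by rewrite ltr0n. Qed.

Definition lip1_dist (f g : lip1) : R :=
  sup (range (fun q : rat => `|f (ratr q) - g (ratr q)| / weight q)).

Lemma lip1_dist_le1 (f g : lip1) x : `|f x - g x| <= 1.
Proof.
have /andP[f0 f1] := lip1_itv f x; have /andP[g0 g1] := lip1_itv g x.
by rewrite ler_norml; apply/andP; split; lra.
Qed.

Lemma lip1_distP (f g : lip1) e :
  lip1_dist f g <= e <-> forall q, `|f (ratr q) - g (ratr q)| <= e * weight q.
Proof.
rewrite /lip1_dist; set S := (X in sup X); have S0 : S !=set0.
  by exists (`|f (ratr 0) - g (ratr 0)| / weight 0); exists 0.
have hS : has_ubound S.
  exists 1 => _ [q _ <-]; rewrite ler_pdivrMr ?weight_gt0// mul1r.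
  by apply: le_trans (lip1_dist_le1 _ _ _) _; rewrite ler1n.
split=> [de q|h]; last first.
  by apply: ge_sup => // _ [q _ <-]; rewrite ler_pdivrMr ?weight_gt0.
rewrite -ler_pdivrMr ?weight_gt0//; apply: le_trans de.
by apply: ub_le_sup => //; exists q.
Qed.

Lemma lip1_dist_rat (f g : lip1) q :
  `|f (ratr q) - g (ratr q)| <= lip1_dist f g * weight q.
Proof. by apply: (lip1_distP f g _).1. Qed.

Lemma lip1_dist_ge0 (f g : lip1) : 0 <= lip1_dist f g.
Proof.
have := lip1_dist_rat f g 0; rewrite -ler_pdivrMr ?weight_gt0//; apply: le_trans.
by rewrite divr_ge0// ltW ?weight_gt0.
Qed.

Lemma lip1_eval_dist (f g : lip1) (x : R) q :
  `|f x - g x| <= 2 * `|x - ratr q| + lip1_dist f g * weight q.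
Proof.
have h1 := lip1_lip f x (ratr q); have h2 := lip1_lip g x (ratr q).
have h3 := lip1_dist_rat f g q.
rewrite (_ : f x - g x = (f x - f (ratr q)) - (g x - g (ratr q)) +
  (f (ratr q) - g (ratr q))); last by ring.
apply: le_trans (ler_normD _ _) _; apply: lerD => //.
by apply: le_trans (ler_normB _ _) _; lra.
Qed.

Lemma near_rat (x e : R) : 0 < e -> exists q : rat, `|x - ratr q| < e.
Proof.
move=> e0; have [q] : exists q : rat, ratr q \in `]x - e, x + e[.
  by apply: rat_in_itvoo; lra.
rewrite in_itv/= => /andP[? ?]; exists q.
by rewrite ltr_norml; apply/andP; split; lra.
Qed.

Lemma lip1_distxx f : lip1_dist f f = 0.
Proof.
apply/eqP; rewrite eq_le lip1_dist_ge0 andbT; apply/lip1_distP => q.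
by rewrite subrr normr0 mul0r.
Qed.

Lemma lip1_dist_eq f g : lip1_dist f g = 0 -> f = g.
Proof.
move=> fg; apply: lip1_eq => x; apply/eqP; rewrite -subr_eq0 -normr_le0.
apply/ler_addgt0Pl => e e0; rewrite addr0.
have [q xq] := near_rat x (divr_gt0 e0 (@ltr0n R 2)).
by apply: le_trans (lip1_eval_dist f g x q) _; rewrite fg; lra.
Qed.

Lemma lip1_distC f g : lip1_dist f g = lip1_dist g f.
Proof.
by congr (sup (image _ _)); apply/funext => q; rewrite distrC.
Qed.

Lemma lip1_dist_triangle g f h : lip1_dist f h <= lip1_dist f g + lip1_dist g h.
Proof.
apply/lip1_distP => q; rewrite mulrDl.
rewrite (_ : f (ratr q) - _ = (f (ratr q) - g (ratr q)) + (g (ratr q) - h (ratr q))); last by ring.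
by apply: le_trans (ler_normD _ _) _; apply: lerD; exact: lip1_dist_rat.
Qed.

HB.instance Definition _ := isMetric.Build R lip1
  lip1_distxx lip1_dist_eq lip1_distC lip1_dist_triangle.

Lemma lip1_ballE (f : lip1) e : ball f e = [set g | lip1_dist f g < e].
Proof. by rewrite ballEmdist. Qed.

Lemma eval_continuous (x : R) : continuous (fun f : lip1 => f x).
Proof.
move=> f; have FF := nbhs_filter f; apply/(@cvg_ballP R _ lip1 (nbhs f) FF) => e e0.
have [q xq] := near_rat x (divr_gt0 e0 (@ltr0n R 4)).
have d0 : 0 < e / 2 / weight q by rewrite !divr_gt0// weight_gt0.
near=> g; rewrite /ball/=; apply: le_lt_trans (lip1_eval_dist f g x q) _.
have : lip1_dist f g < e / 2 / weight q.
  by near: g; have := nbhsx_ballx f _ d0; rewrite lip1_ballE.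
by rewrite ltr_pdivlMr ?weight_gt0//; lra.
Unshelve. all: by end_near. Qed.

Lemma lip1_complete (F : set_system lip1) : ProperFilter F -> cauchy F ->
  exists f : lip1, F --> f.
Proof.
move=> PF /cauchyP cF.
have cvgx x : cvg ((fun f : lip1 => f x : R^o) @ F).
  apply/cauchy_cvgP/cauchy_exP => e e0.
  have [q xq] := near_rat x (divr_gt0 e0 (@ltr0n R 4)).
  have d0 : 0 < e / 2 / weight q by rewrite !divr_gt0// weight_gt0.
  have [f Ff] := cF _ d0; exists (f x); rewrite lip1_ballE in Ff.
  change (F [set g : lip1 | `|f x - g x| < e]); apply: filterS Ff => g /= fg.
  apply: le_lt_trans (lip1_eval_dist f g x q) _.
  by move: fg; rewrite ltr_pdivlMr ?weight_gt0//; lra.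
pose l x : R := lim ((fun f : lip1 => f x : R^o) @ F).
have ll x e : 0 < e -> \forall f \near F, `|l x - (f : lip1) x| < e.
  by move=> e0; move/cvg_ballP: (cvgx x) => /(_ e e0).
have l01 x : 0 <= l x <= 1.
  apply/andP; split; apply/ler_addgt0Pl => e e0; near F => f.
    have : `|l x - f x| < e by near: f; exact: ll.
    by have := lip1_itv f x; rewrite ltr_norml => /andP[? ?] /andP[? ?]; lra.
  have : `|l x - f x| < e by near: f; exact: ll.
  by have := lip1_itv f x; rewrite ltr_norml => /andP[? ?] /andP[? ?]; lra.
have llip x y : `|l x - l y| <= `|x - y|.
  apply/ler_addgt0Pl => e e0; near F => f.
  have h1 : `|l x - f x| < e / 2 by near: f; apply: ll; rewrite divr_gt0.
  have h2 : `|l y - f y| < e / 2 by near: f; apply: ll; rewrite divr_gt0.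
  have h3 := lip1_lip f x y.
  rewrite (_ : l x - l y = (l x - f x) - (l y - f y) + (f x - f y)); last by ring.
  apply: le_trans (ler_normD _ _) _; apply: lerD => //.
  by apply: le_trans (ler_normB _ _) _; lra.
exists (Lip1 l01 llip); apply/fcvg_ballP => e e0.
have e30 : 0 < e / 3 by rewrite divr_gt0.
have [f Ff] := cF _ e30.
have fl : lip1_dist f (Lip1 l01 llip) <= e / 3.
  apply/lip1_distP => q /=; apply/ler_addgt0Pl => d d0; near F => g.
  have h1 : `|l (ratr q) - g (ratr q)| < d by near: g; exact: ll.
  have h2 : lip1_dist f g < e / 3 by near: g; move: Ff; rewrite lip1_ballE.
  rewrite (_ : f (ratr q) - l (ratr q) =
    - (l (ratr q) - g (ratr q)) + (f (ratr q) - g (ratr q))); last by ring.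
  apply: le_trans (ler_normD _ _) _; rewrite normrN; apply: lerD; first exact: ltW.
  apply: le_trans (lip1_dist_rat f g q) _.
  by rewrite ler_pM2r ?weight_gt0// ltW.
rewrite lip1_ballE in Ff *; apply: filterS Ff => g /= fg.
apply: le_lt_trans (lip1_dist_triangle f _ _) _.
by rewrite lip1_distC; lra.
Unshelve. all: by end_near. Qed.

(** Functions with approximately prescribed values at finitely many rationals.
    There are countably many cells, and one representative in each suffices for
    density. *)
Definition cell (c : rat * seq (rat * rat)) : set lip1 :=
  [set f | forall p, p \in c.2 -> `|f (ratr p.1) - ratr p.2| <= ratr c.1].

Definition cell_repr c : lip1 := get (cell c).

Lemma cell_repr_dense (f : lip1) (e : R) : 0 < e ->
  exists c, lip1_dist f (cell_repr c) < e.
Proof.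
move=> e0; have [d /andP[d0 de]] : exists d : rat, 0 < (ratr d : R) < e / 4.
  have [d] : exists d : rat, ratr d \in `]0, e / 4[ by apply: rat_in_itvoo; rewrite divr_gt0.
  by rewrite in_itv/=; exists d.
have [N eN] : exists N : nat, 2 / e < N%:R.
  by exists (Num.bound (2 / e)); apply: archi_boundP; rewrite divr_ge0 ?ltW.
have /choice[r fr] (q : rat) := near_rat (f (ratr q)) d0.
pose c := (d, [seq (q, r q) | q <- pmap (@choice.unpickle rat) (iota 0 N)]).
have cf : cell c f by move=> _ /mapP[q _ ->] /=; exact/ltW/fr.
have cg : cell c (cell_repr c) by apply: getPex; exists f.
exists c; apply: (@le_lt_trans _ _ (e / 2)); last by lra.
apply/lip1_distP => q; have [qN|qN] := ltnP (choice.pickle q) N.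
  have qc : (q, r q) \in c.2.
    apply/map_f; rewrite mem_pmap; apply/mapP; exists (choice.pickle q).
      by rewrite mem_iota.
    by rewrite choice.pickleK.
  have h1 := cf _ qc; have h2 := cg _ qc; rewrite /= in h1 h2.
  apply: (@le_trans _ _ (e / 2)); last by rewrite ler_peMr// ?ler1n// ltW// divr_gt0.
  rewrite (_ : f (ratr q) - _ = (f (ratr q) - ratr (r q)) -
    (cell_repr c (ratr q) - ratr (r q))); last by ring.
  by apply: le_trans (ler_normB _ _) _; lra.
apply: le_trans (lip1_dist_le1 _ _ _) _.
move: eN; rewrite ltr_pdivrMr// => eN.
have : (N%:R <= weight q) by rewrite /weight ler_nat ltnW.
by nra.
Qed.

Lemma lip1_separable : exists2 D : set lip1, countable D & dense D.
Proof.
exists (range cell_repr); first by apply: sub_countable (card_image_le _ _) (countableP _).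
move=> A [f Af] oA; have /nbhs_ballP[e /= e0 feA] : nbhs f A by exact: open_nbhs_nbhs.
have [c fc] := cell_repr_dense f e0; exists (cell_repr c); split; last by exists c.
by apply: feA; rewrite lip1_ballE.
Qed.

End path_space.

(** * Void events, Borel sets and translations *)

Lemma bigcapT_measurable_count d (T : measurableType d) (I : countType)
    (F : I -> set T) :
  (forall i, measurable (F i)) -> measurable (\bigcap_i F i).
Proof.
move=> mF; rewrite -[X in measurable X]setCK setC_bigcap; apply: measurableC.
apply: countable_bigcupT_measurable => [|i]; first exact: countableP.
exact: measurableC.
Qed.

Section path_events.
Context {R : realType}.
Notation Y := (@lip1 R).

Definition path_space : Type := g_sigma_algebraType (@open Y).
HB.instance Definition _ := Measurable.on path_space.
HB.instance Definition _ := Pointed.on path_space.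

(** For the distance to a closed set, cut at 1, and radii at most 1, this is the
    event that no ball of l meets the set. *)
Definition above (l : seq (R * R)) : set Y :=
  [set f | forall e, e \in l -> e.2 <= f e.1].

(** A radius larger than 1 would give the empty event, whatever the ball. *)
Definition above_sets : set (set Y) :=
  [set above l | l in [set l | all (fun e : R * R => e.2 <= 1) l]].

Lemma above_cat l l' : above (l ++ l') = above l `&` above l'.
Proof.
apply/seteqP; split => f /=.
  by move=> h; split => e el; apply: h; rewrite mem_cat el ?orbT.
by move=> [h h'] e; rewrite mem_cat => /orP[/h|/h'].
Qed.

Lemma above_nil : above [::] = setT.
Proof. by apply/seteqP; split. Qed.

Lemma above1 x s : above [:: (x, s)] = [set f | s <= f x].
Proof.
apply/seteqP; split => f /=; first by move=> h; exact: (h (x, s) (mem_head _ _)).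
by move=> h e; rewrite inE => /eqP->.
Qed.

Lemma above_sets_setI : setI_closed above_sets.
Proof.
move=> _ _ [l l1 <-] [l' l'1 <-]; exists (l ++ l'); last by rewrite above_cat.
by rewrite /= all_cat; apply/andP.
Qed.

Let Z := g_sigma_algebraType above_sets.

Let measurable_eval_above (x : R) :
  measurable_fun [set: Z] (fun f : Z => (f : Y) x : measurableTypeR R).
Proof.
apply: (measurability _ (RGenCInfty.measurableE R)) => //.
move=> _ [_ [s ->] <-]; rewrite setTI.
have [s1|s1] := leP s 1.
  apply: sub_sigma_algebra; exists [:: (x, s)]; first by rewrite /= s1.
  by rewrite above1; apply/seteqP; split => f /=; rewrite in_itv/= andbT.
rewrite (_ : _ @^-1` _ = set0); first exact: measurable0.
apply/seteqP; split => f //=; rewrite in_itv/= andbT.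
have /andP[_ f1] := lip1_itv (f : Y) x; lra.
Qed.

(** Open sets are countable unions of closed balls around representatives of
    cells, and a closed ball is a countable intersection of conditions on values
    at rationals. Conversely the evaluations are continuous. *)
Lemma open_above_sets : <<s @open Y >> = <<s above_sets >>.
Proof.
apply/seteqP; split.
  apply: smallest_sub; first exact: smallest_sigma_algebra.
  move=> A oA.
  pose D := [set c : (rat * seq (rat * rat)) * rat |
    [set f : Y | lip1_dist (cell_repr c.1) f <= ratr c.2] `<=` A].
  have -> : A = \bigcup_(c in D) [set f : Y | lip1_dist (cell_repr c.1) f <= ratr c.2].
    apply/seteqP; split => f; last by move=> [c Dc] /Dc.
    move=> Af; have /nbhs_ballP[e /= e0 feA] : nbhs f A by exact: open_nbhs_nbhs.
    have e40 : 0 < e / 4 by rewrite divr_gt0.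
    have [c fc] := cell_repr_dense f e40.
    have [r] : exists r : rat, ratr r \in `]e / 4, e / 2[ by apply: rat_in_itvoo; lra.
    rewrite in_itv/= => /andP[r1 r2].
    exists (c, r) => /=; last by rewrite lip1_distC; lra.
    move=> g /= cg; apply: feA; rewrite lip1_ballE/=.
    by apply: le_lt_trans (lip1_dist_triangle (cell_repr c) _ _) _; lra.
  have mD (c : (rat * seq (rat * rat)) * rat) : @measurable _ Z
      (if c \in D then [set f : Y | lip1_dist (cell_repr c.1) f <= ratr c.2] else set0).
    case: ifP => _; last exact: measurable0.
    rewrite (_ : [set f | _] = \bigcap_(q : rat) ((fun f : Z => (f : Y) (ratr q)) @^-1`
      `[cell_repr c.1 (ratr q) - ratr c.2 * weight q,
        cell_repr c.1 (ratr q) + ratr c.2 * weight q])).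
      apply: (@bigcapT_measurable_count _ Z) => q; rewrite -[X in measurable X]setTI.
      by apply: measurable_eval_above => //; exact: measurable_itv.
    apply/seteqP; split => f /=.
      move=> /lip1_distP h q _ /=; have := h q; rewrite in_itv/= ler_norml => /andP[? ?].
      by apply/andP; split; lra.
    move=> h; apply/lip1_distP => q; have := h q I; rewrite /= in_itv/= ler_norml.
    by move=> /andP[? ?]; apply/andP; split; lra.
  rewrite bigcup_mkcond.
  apply: (@countable_bigcupT_measurable _ Z) => //; exact: countableP.
apply: smallest_sub; first exact: smallest_sigma_algebra.
move=> _ [l _ <-].
elim: l => [|[x s] l IHl].
  by rewrite above_nil; exact: (@measurableT _ path_space).
rewrite -cat1s above_cat above1; apply: (@measurableI _ path_space) => //.
suff oP : open (~` [set f : Y | s <= f x]).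
  have mP : @measurable _ path_space (~` [set f : Y | s <= f x]) by exact: sub_sigma_algebra.
  by have := measurableC mP; rewrite setCK.
rewrite openE => f /= /negP; rewrite -ltNge => fs.
have := @eval_continuous R x f; move/cvg_ballP => /(_ (s - f x)).
rewrite subr_gt0 => /(_ fs); apply: filterS => g.
rewrite /ball/= => gs; apply/negP; rewrite -ltNge.
by move: gs; rewrite ltr_norml => /andP[? ?]; lra.
Qed.

Lemma measurable_path_spaceE : @measurable _ path_space = <<s above_sets >>.
Proof. exact: open_above_sets. Qed.

Lemma measurable_eval (x : R) :
  measurable_fun [set: path_space] (fun f : path_space => (f : Y) x : measurableTypeR R).
Proof.
by move=> _ B mB; rewrite measurable_path_spaceE; exact: measurable_eval_above.
Qed.

Lemma measurable_eval_ge (x s : R) : @measurable _ path_space [set f : Y | s <= f x].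
Proof.
have := measurable_eval x measurableT (measurable_itv `[s, +oo[).
rewrite setTI; congr (measurable _).
by apply/seteqP; split => f /=; rewrite in_itv/= andbT.
Qed.

Lemma measurable_above l : @measurable _ path_space (above l).
Proof.
elim: l => [|[x s] l IHl]; first by rewrite above_nil; exact: (@measurableT _ path_space).
rewrite -cat1s above_cat above1; apply: (@measurableI _ path_space) => //.
exact: measurable_eval_ge.
Qed.

Lemma standard_borel_path_space : standard_borel R path_space.
Proof.
exists Y, id; split.
- exact: lip1_complete.
- exact: lip1_separable.
- by exists id.
- by apply/seteqP; split => [A mA|_ [B mB <-]]; [exists A|].
Qed.

Lemma flow_itv (t : R) (f : Y) x : 0 <= f (x + t) <= 1.
Proof. exact: lip1_itv. Qed.

Lemma flow_lip (t : R) (f : Y) x y : `|f (x + t) - f (y + t)| <= `|x - y|.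
Proof.
by apply: le_trans (lip1_lip _ _ _) _; rewrite opprD addrACA subrr addr0.
Qed.

Definition flow (t : R) (f : path_space) : path_space := Lip1 (flow_itv t f) (@flow_lip t f).

Lemma flow_zero f : flow 0 f = f.
Proof. by apply: lip1_eq => x /=; rewrite addr0. Qed.

Lemma flow_add s t f : flow (s + t) f = flow s (flow t f).
Proof. by apply: lip1_eq => x /=; rewrite addrA. Qed.

Lemma flow_above t l :
  flow t @^-1` above l = above [seq (e.1 + t, e.2) | e <- l].
Proof.
apply/seteqP; split => f /= h.
  by move=> _ /mapP[e el ->] /=; exact: h.
by move=> e el; apply: (h (e.1 + t, e.2)); apply/mapP; exists e.
Qed.

(** Since f is 1-Lipschitz, f (x + t) < s if and only if f q < s - r for some
    rationals q and r with |x + t - q| < r: a countable union of rectangles. *)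
Lemma flow_jointly_measurable : measurable_fun [set: measurableTypeR R * path_space]
  (fun z : measurableTypeR R * path_space => flow z.1 z.2).
Proof.
apply: (measurability _ measurable_path_spaceE) => _ [_ [l _ <-] <-]; rewrite setTI.
elim: l => [|[x s] l IHl]; first by rewrite above_nil preimage_setT; exact: measurableT.
rewrite -cat1s above_cat above1 preimage_setI; apply: measurableI => //.
rewrite -[X in measurable X]setCK; apply: measurableC.
rewrite (_ : ~` _ = \bigcup_(p : rat * rat)
   (ball (ratr p.1 - x) (ratr p.2) `*` [set f : path_space | (f : Y) (ratr p.1) < s - ratr p.2])).
  apply: countable_bigcupT_measurable => [|p]; first exact: countableP.
  apply: measurableX; first exact: measurable_ball.
  have := @measurableC _ path_space _ (measurable_eval_ge (ratr p.1) (s - ratr p.2)).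
  congr (measurable _); apply/seteqP; split => f /=; first by move/negP; rewrite ltNge.
  by rewrite ltNge => /negP.
apply/seteqP; split => -[t f] /=.
  move=> /negP; rewrite -ltNge => fs.
  have d0 : 0 < (s - f (x + t)) / 2 by rewrite divr_gt0// subr_gt0.
  have [r] : exists r : rat, ratr r \in `]0, (s - f (x + t)) / 2[ by exact: rat_in_itvoo.
  rewrite in_itv/= => /andP[r0 rd]; have [q xq] := near_rat (x + t) r0.
  exists (q, r) => //=; split.
    by rewrite /ball/= distrC opprB addrA [t + x]addrC.
  have := lip1_lip f (x + t) (ratr q); rewrite ler_norml => /andP[? ?].
  by rewrite ltrBrDr; lra.
move=> [[q r] _ /= [] ]; rewrite /ball/= => xq fq; apply/negP; rewrite -ltNge.
have := lip1_lip f (x + t) (ratr q).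
rewrite (_ : x + t - ratr q = - (ratr q - x - t)); last by ring.
by rewrite normrN ler_norml => /andP[? ?]; lra.
Qed.

End path_events.

(** * The stationary law *)

Section stationary_law.
Context {R : realType}.
Notation Y := (@lip1 R).
Notation Xt := (@path_space R).
Notation E := (R * R)%type.

Definition rat_ball (k : nat) : E :=
  if @choice.unpickle (rat * rat)%type k is Some p then (ratr p.1, `|ratr p.2|)
  else (0, 0).

Lemma rat_ball_ge0 k : 0 <= (rat_ball k).2.
Proof. by rewrite /rat_ball; case: choice.unpickle => [p|] /=. Qed.

Lemma rat_ball_onto (q r : rat) : 0 <= (ratr r : R) ->
  exists k, rat_ball k = (ratr q, ratr r).
Proof.
by move=> r0; exists (choice.pickle (q, r)); rewrite /rat_ball choice.pickleK/= ger0_norm.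
Qed.

Let V : nat -> set (measurableTypeR R) := void_event (@avoid R) rat_ball.

(** If the k-th rational ball is hit, the distance from x to the random set is
    less than the distance from x to its centre plus its radius. *)
Definition miss_dists (u x : R) : set R :=
  [set y | y = 1 \/ exists2 k, ~ V k u & y = `|x - (rat_ball k).1| + (rat_ball k).2].

Definition hit_dist (u x : R) : R := inf (miss_dists u x).

Let miss_dists_lb u x : lbound (miss_dists u x) 0.
Proof.
move=> _ [->|[k _ ->]]; first exact: ler01.
by rewrite addr_ge0// rat_ball_ge0.
Qed.

Let miss_dists_n0 u x : miss_dists u x !=set0.
Proof. by exists 1; left. Qed.

Let has_lb u x : has_lbound (miss_dists u x).
Proof. by exists 0; exact: miss_dists_lb. Qed.

Lemma hit_dist_geP u x s : s <= 1 -> s <= hit_dist u x <->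
  forall k, `|x - (rat_ball k).1| + (rat_ball k).2 < s -> V k u.
Proof.
move=> s1; split=> [sx k|h].
  apply: contraPP => nV; apply/negP; rewrite -leNgt; apply: le_trans sx _.
  by apply: ge_inf => //; right; exists k.
apply: lb_le_inf => // _ [->//|[k nV ->]]; rewrite leNgt; apply/negP => /h.
exact: nV.
Qed.

Lemma hit_dist_itv u x : 0 <= hit_dist u x <= 1.
Proof.
apply/andP; split; first by apply: lb_le_inf => //; exact: miss_dists_lb.
by apply: ge_inf => //; left.
Qed.

Let hit_dist_lip1 u x y : hit_dist u x <= hit_dist u y + `|x - y|.
Proof.
rewrite -lerBlDr; apply: lb_le_inf => // _ [->|[k nV ->]]; rewrite lerBlDr.
  by have /andP[_ h] := hit_dist_itv u x; have := normr_ge0 (x - y); lra.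
apply: (@le_trans _ _ (`|x - (rat_ball k).1| + (rat_ball k).2)).
  by apply: ge_inf => //; right; exists k.
have := ler_normD (y - (rat_ball k).1) (x - y).
by rewrite addrC addrA subrK; lra.
Qed.

Lemma hit_dist_lip u x y : `|hit_dist u x - hit_dist u y| <= `|x - y|.
Proof.
have h1 := hit_dist_lip1 u x y; have := hit_dist_lip1 u y x; rewrite distrC => h2.
by rewrite ler_norml; apply/andP; split; lra.
Qed.

Definition random_path (u : measurableTypeR R) : Xt :=
  Lip1 (hit_dist_itv u) (hit_dist_lip u).

(** Contained in a ball of l, with some margin. *)
Definition inner_ball (l : seq E) (k : nat) : bool :=
  has (fun e : E => `|e.1 - (rat_ball k).1| + (rat_ball k).2 < e.2) l.

Lemma random_path_above l : all (fun e : E => e.2 <= 1) l ->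
  random_path @^-1` above l = \bigcap_k (if inner_ball l k then V k else setT).
Proof.
move=> /allP l1; apply/seteqP; split => u /= h.
  move=> k _; case: ifPn => // /hasP[e el].
  by apply: (hit_dist_geP _ _ (l1 _ el)).1; exact: h.
move=> e el; apply/(hit_dist_geP _ _ (l1 _ el)) => k ek.
by have := h k I; rewrite ifT//; apply/hasP; exists e.
Qed.

Let mV k : measurable (V k).
Proof. exact: measurable_void_event. Qed.

Lemma measurable_random_path : measurable_fun setT random_path.
Proof.
apply: (measurability _ measurable_path_spaceE) => _ [_ [l l1 <-] <-]; rewrite setTI.
rewrite random_path_above//; apply: bigcapT_measurable_count => k.
by case: ifP.
Qed.

Lemma balls_chosen_sub l n :
  balls (chosen rat_ball (inner_ball l) n) `<=` balls l.
Proof.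
elim: n => //= n IHn; case: ifPn => //= /hasP[e el ek] y [] //; last exact: IHn.
rewrite /ball/= => ny; apply/ballsP; exists e => //; rewrite /ball/=.
have := ler_normD (e.1 - (rat_ball n).1) ((rat_ball n).1 - y).
by rewrite addrA subrK; lra.
Qed.

Lemma balls_chosenS S n :
  balls (chosen (@rat_ball) S n) `<=` balls (chosen rat_ball S n.+1).
Proof. by move=> y /=; case: ifP => // _; right. Qed.

Lemma bigcup_balls_chosen l :
  \bigcup_n balls (chosen rat_ball (inner_ball l) n) = balls l.
Proof.
apply/seteqP; split => y; first by move=> [n _] /balls_chosen_sub.
move=> /ballsP[e el]; rewrite /ball/= => ey.
have d0 : 0 < (e.2 - `|e.1 - y|) / 4 by rewrite divr_gt0// subr_gt0.
have [r] : exists r : rat, ratr r \in `]0, (e.2 - `|e.1 - y|) / 4[ by exact: rat_in_itvoo.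
rewrite in_itv/= => /andP[r0 rd]; have [q yq] := near_rat y r0.
have [k kE] := rat_ball_onto q (ltW r0).
exists k.+1 => //=; rewrite ifT.
  by left; rewrite kE/= /ball/= distrC.
apply/hasP; exists e => //; rewrite kE/=.
have := ler_normD (e.1 - y) (y - ratr q).
by rewrite addrA subrK; lra.
Qed.

(** The rational balls inside the balls of l exhaust their union, up to a set of
    small length, which bounds the variation of [dens]. *)
Lemma cvg_avoid_chosen l :
  avoid (chosen rat_ball (inner_ball l) n) @[n --> \oo] --> (avoid l : R).
Proof.
apply: continuous_cvg; first exact: continuous_expR.
apply: cvgN; set C := fun n => balls (chosen rat_ball (inner_ball l) n).
have fC n : finm (C n) by exact: finm_balls.
have fl := finm_balls l.
have fD n : finm (balls l `\` C n).
  apply: finmS fl; last exact: subDsetl.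
  by apply: measurableD; [case: (finm_balls l)|case: (fC n)].
have lenC : len (C n) @[n --> \oo] --> len (balls l).
  apply: fine_cvg; rewrite finmE// -(bigcup_balls_chosen l).
  have mC n : measurable (C n) by case: (fC n).
  apply: nondecreasing_cvg_mu; [exact: mC|exact: bigcup_measurable|].
  by apply/nondecreasing_seqP => n; apply/subsetPset; exact: balls_chosenS.
apply: (@squeeze_cvgr _ _ _ _ (fun n => dens (balls l) - (len (balls l) - len (C n)))
   (fun=> dens (balls l))).
- apply: nearW => n; apply/andP; split.
    rewrite lerBlDr; have := dens_le_lenD (fC n) (fD n).
    rewrite setDUK; last exact: balls_chosen_sub.
    rewrite lenD//; last by case: (fC n).
    by rewrite setIC (setIidl (@balls_chosen_sub l n)).
  by apply: le_dens => //; [case: (fC n)|exact: balls_chosen_sub].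
- rewrite -[X in _ --> X]subr0 -(subrr (len (balls l))).
  by apply: cvgB; [exact: cvg_cst|apply: cvgB => //; exact: cvg_cst].
- exact: cvg_cst.
Qed.

(** The infimum is at least s at x exactly when all rational balls well inside the
    ball of radius s around x are missed: a decreasing sequence of events of
    known probability. *)
Lemma unit_prob_above l : all (fun e : E => e.2 <= 1) l ->
  unit_prob (random_path @^-1` above l) = (avoid l)%:E.
Proof.
move=> l1.
pose A n := [set u | forall k, (k < n)%N -> inner_ball l k -> V k u].
have PA n : unit_prob (A n) = (avoid (chosen rat_ball (inner_ball l) n))%:E.
  exact: (unit_prob_void_events _ cm_avoid avoid_nil).
have mA n : measurable (A n).
  rewrite (_ : A n = \bigcap_(k in `I_n) (if inner_ball l k then V k else setT)).
    by apply: fin_bigcap_measurable => // k _; case: ifP.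
  apply/seteqP; split => u /= h k kn.
    by case: ifP => // ik; exact: h.
  by move=> ik; have := h k kn; rewrite ik.
have AE : random_path @^-1` above l = \bigcap_n A n.
  rewrite random_path_above//; apply/seteqP; split => u h.
    by move=> n _ k _ ik; have := h k I; rewrite ik.
  by move=> k _; case: ifP => // ik; exact: (h k.+1 I k (leqnn _) ik).
rewrite AE; have cA : unit_prob (A n) @[n --> \oo] --> unit_prob (\bigcap_n A n).
  apply: nonincreasing_cvg_mu => //.
  - by rewrite [X in (X < _)%E](PA 0%N) ltry.
  - by apply: bigcapT_measurable => n.
  - apply/nonincreasing_seqP => n; apply/subsetPset => u h k kn.
    by apply: h; exact: ltnW.
have cB : unit_prob (A n) @[n --> \oo] --> (avoid l)%:E.
  rewrite (_ : (fun n => _) = fun n => (avoid (chosen rat_ball (inner_ball l) n))%:E); last exact/funext.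
  by apply: cvg_EFin; [exact: nearW|exact: cvg_avoid_chosen].
exact: cvg_unique cA cB.
Qed.

HB.instance Definition _ := isMeasurableFun.Build _ _ _ _ random_path measurable_random_path.

Definition path_law : probability Xt R := distribution unit_prob random_path.

Lemma path_law_above l : all (fun e : E => e.2 <= 1) l -> path_law (above l) = (avoid l)%:E.
Proof. exact: unit_prob_above. Qed.

End stationary_law.

(** * Averages along a flow *)

Section flow_averages.
Context {R : realType} d (S : measurableType d).
Variables (mu : probability S R) (T : R -> S -> S).
Hypothesis T_flow : mp_flow mu T.
Notation RR := (measurableTypeR R).
Implicit Types (nu : probability RR R) (t : R) (g h : S -> R).

Definition atomless nu := forall r : R, nu [set r] = 0%E.

Definition avg nu t g (x : S) : R := \int[nu]_r g (T (r * t) x).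

Definition deviation nu t g : \bar R :=
  (\int[mu]_x `|avg nu t g x - \int[mu]_y g y|%:E)%E.

(** The convergence to 0 is written with bounds so that approximation arguments
    need not compare limits. *)
Definition averaging g : Prop := forall nu, atomless nu -> forall e : R, 0 < e ->
  \forall t \near +oo, (deviation nu t g <= e%:E)%E.

Let mT t : measurable_fun setT (T t).
Proof.
have := flow_measurable T_flow; move=> mF.
exact: (measurableT_comp mF (measurable_pair1 t)).
Qed.

Let orbit t (z : S * RR) : S := T (z.2 * t) z.1.

Lemma measurable_orbit t : measurable_fun [set: S * RR] (orbit t).
Proof.
have mF := flow_measurable T_flow.
apply: (@measurableT_comp _ _ _ _ _ _ (fun z : RR * S => T z.1 z.2) _
  (fun z : S * RR => ((z.2 * t : RR), z.1))) => //.
apply/measurable_fun_pairP; split => /=; last exact: measurable_fst.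
by apply: measurable_funM => //; exact: measurable_snd.
Qed.

Lemma measurable_orbitr t x : measurable_fun [set: RR] (fun r : RR => T (r * t) x).
Proof. exact: (measurableT_comp (measurable_orbit t) (measurable_pair1 x)). Qed.

Lemma measurable_flow t : measurable_fun setT (T t).
Proof. exact: mT. Qed.

Lemma integral_flow t (k : S -> \bar R) : measurable_fun setT k ->
  (forall x, 0 <= k x)%E -> (\int[mu]_x k (T t x) = \int[mu]_x k x)%E.
Proof.
move=> mk k0; transitivity (\int[pushforward mu (T t)]_x k x)%E.
  by rewrite ge0_integral_pushforward.
by apply: eq_measure_integral => // A mA _; exact: flow_preserving.
Qed.

Lemma integral_orbit nu t (k : S -> \bar R) : measurable_fun setT k ->
  (forall x, 0 <= k x)%E ->
  (\int[mu]_x \int[nu]_r k (T (r * t) x) = \int[mu]_x k x)%E.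
Proof.
move=> mk k0.
have := @fubini_tonelli _ _ S RR R mu nu (fun z => k (orbit t z)).
rewrite /fubini_F /fubini_G /orbit/= => ->//; last first.
  exact: measurableT_comp mk (measurable_orbit t).
under eq_integral do rewrite integral_flow//.
by rewrite integral_cst//= probability_setT mule1.
Qed.

Lemma measurable_orbit_integral nu t (k : S -> \bar R) : measurable_fun setT k ->
  (forall x, 0 <= k x)%E -> measurable_fun setT (fun x => \int[nu]_r k (T (r * t) x))%E.
Proof.
move=> mk k0.
apply: (@measurable_fun_fubini_tonelli_F _ _ S RR R nu (fun z => k (orbit t z))) => //.
exact: measurableT_comp mk (measurable_orbit t).
Qed.

Lemma measurable_avg nu t g : measurable_fun setT g -> measurable_fun setT (avg nu t g).
Proof.
move=> mg; apply: (measurableT_comp (@fine_measurable R setT measurableT)).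
have mEg : measurable_fun setT (EFin \o g) by exact/measurable_EFinP.
rewrite (_ : (fun x => _) = fun x =>
   (\int[nu]_r (EFin \o g)^\+ (T (r * t) x) - \int[nu]_r (EFin \o g)^\- (T (r * t) x))%E).
  apply: emeasurable_funB; apply: measurable_orbit_integral => //.
  - exact: measurable_funepos.
  - exact: measurable_funeneg.
apply/funext => x; rewrite [LHS]integralE.
by congr (_ - _)%E; apply: eq_integral => r _; rewrite ?funeposE ?funenegE.
Qed.

Definition bounded_mfun g := measurable_fun setT g /\ exists M : R, forall x, `|g x| <= M.

Lemma bounded_mfun_int g : bounded_mfun g -> mu.-integrable setT (EFin \o g).
Proof.
move=> [mg [M gM]]; apply: measurable_bounded_integrable => //.
  exact: (le_lt_trans (probability_le1 mu measurableT) (ltry 1)).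
by exists M; split; [exact: num_real|move=> N MN x _; apply: le_trans (gM x) (ltW MN)].
Qed.

Lemma bounded_mfun_orbit_int nu t g x : bounded_mfun g ->
  nu.-integrable setT (EFin \o (fun r : RR => g (T (r * t) x))).
Proof.
move=> [mg [M gM]]; apply: measurable_bounded_integrable => //.
- exact: (le_lt_trans (probability_le1 nu measurableT) (ltry 1)).
- exact: measurableT_comp mg (measurable_orbitr t x).
by exists M; split; [exact: num_real|move=> N MN r _; apply: le_trans (gM _) (ltW MN)].
Qed.

Let measurable_dev nu t g : measurable_fun setT g ->
  measurable_fun setT (fun x => (`|avg nu t g x - \int[mu]_y g y|%:E)).
Proof.
move=> mg; apply/measurable_EFinP; apply: measurableT_comp => //.
by apply: measurable_funB => //; exact: measurable_avg.
Qed.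

Lemma averagingD g h : bounded_mfun g -> bounded_mfun h ->
  averaging g -> averaging h -> averaging (fun x => g x + h x).
Proof.
move=> bg bh ag ah nu anu e e0; have e20 : 0 < e / 2 by rewrite divr_gt0.
near=> t.
have dg : (deviation nu t g <= (e / 2)%:E)%E by near: t; exact: ag.
have dh : (deviation nu t h <= (e / 2)%:E)%E by near: t; exact: ah.
rewrite [in leRHS](splitr e) EFinD; apply: le_trans (leeD dg dh).
have [mg _] := bg; have [mh _] := bh.
rewrite /deviation -ge0_integralD//=; [|exact: measurable_dev|exact: measurable_dev].
apply: ge0_le_integral => //=.
- by apply: measurable_dev; exact: measurable_funD.
- by apply: emeasurable_funD; exact: measurable_dev.
move=> x _; rewrite -EFinD lee_fin.
rewrite /avg RintegralD//; try exact: bounded_mfun_orbit_int.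
rewrite RintegralD//; try exact: bounded_mfun_int.
by rewrite opprD addrACA; exact: ler_normD.
Unshelve. all: by end_near. Qed.

Lemma averagingZ (c : R) g : bounded_mfun g -> averaging g ->
  averaging (fun x => c * g x).
Proof.
move=> bg ag nu anu e e0; have c0 : 0 < `|c| + 1 by rewrite ltr_wpDl.
have ec0 : 0 < e / (`|c| + 1) by rewrite divr_gt0.
near=> t.
have dg : (deviation nu t g <= (e / (`|c| + 1))%:E)%E by near: t; exact: ag.
have [mg _] := bg.
apply: (@le_trans _ _ (`|c|%:E * deviation nu t g)%E).
  rewrite /deviation -ge0_integralZl//; [|exact: measurable_dev].
  apply: ge0_le_integral => //=.
  - by apply: measurable_dev; exact: measurable_funM.
  - by apply: measurable_funeM; exact: measurable_dev.
  move=> x _; rewrite -EFinM lee_fin.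
  rewrite /avg RintegralZl//; last exact: bounded_mfun_orbit_int.
  rewrite RintegralZl//; last exact: bounded_mfun_int.
  by rewrite -mulrBr normrM.
apply: le_trans (lee_wpmul2l _ dg) _ => //.
rewrite -EFinM lee_fin mulrCA ger_pMr// ler_pdivrMr// mul1r.
by rewrite lerDl.
Unshelve. all: by end_near. Qed.

(** The average is a contraction of L1, by Tonelli's theorem. Boundedness of h
    gives, at every x, the integrability of h along the orbit of x; then either g - h is
    not integrable along this orbit and the pointwise bound is infinite, or g is
    integrable too. *)
Lemma averaging_approx g : mu.-integrable setT (EFin \o g) ->
  (forall e : R, 0 < e -> exists h, [/\ bounded_mfun h, averaging h &
     (\int[mu]_x `|g x - h x|%:E <= e%:E)%E]) -> averaging g.
Proof.
move=> ig apx nu anu e e0; have e30 : 0 < e / 3 by rewrite divr_gt0.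
have [h [bh ah gh]] := apx _ e30; have [mh _] := bh.
have mg : measurable_fun setT g by apply/measurable_EFinP; case/integrableP: ig.
have mgh : measurable_fun setT (fun x => `|g x - h x|%:E).
  by apply/measurable_EFinP; apply: measurableT_comp => //; exact: measurable_funB.
have igh : `|\int[mu]_y g y - \int[mu]_y h y| <= e / 3.
  rewrite -RintegralB//; last exact: bounded_mfun_int.
  have igh : mu.-integrable setT (EFin \o (fun x => g x - h x)).
    exact: (integrableB measurableT ig (bounded_mfun_int bh)).
  apply: le_trans (le_normr_Rintegral measurableT igh) _.
  rewrite -lee_fin /Rintegral fineK//.
  by apply: integrable_fin_num => //; exact: integrable_abse igh.
near=> t.
have dh : (deviation nu t h <= (e / 3)%:E)%E by near: t; exact: ah.
have -> : e%:E = ((e / 3)%:E + (e / 3)%:E + (e / 3)%:E)%E.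
  by rewrite -!EFinD; congr EFin; lra.
have mI := @measurable_orbit_integral nu t _ mgh (fun x => normr_ge0 (g x - h x)).
apply: (@le_trans _ _ (\int[mu]_x (`|avg nu t h x - \int[mu]_y h y|%:E
   + \int[nu]_r (`|g (T (r * t) x) - h (T (r * t) x)|%:E) + (e / 3)%:E))%E).
  apply: ge0_le_integral => //=.
  - exact: measurable_dev.
  - apply: emeasurable_funD => //; apply: emeasurable_funD => //; exact: measurable_dev.
  move=> x _.
  have [->|] := eqVneq (\int[nu]_r (`|g (T (r * t) x) - h (T (r * t) x)|%:E))%E +oo%E.
    by rewrite addeC addey// leey.
  rewrite -ltey => fin.
  have iox : nu.-integrable setT (EFin \o (fun r : RR => g (T (r * t) x) - h (T (r * t) x))).
    apply/integrableP; split => //; apply/measurable_EFinP.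
    by apply: measurable_funB; apply: measurableT_comp => //; exact: measurable_orbitr.
  have ihx := bounded_mfun_orbit_int nu t x bh.
  have igx : nu.-integrable setT (EFin \o (fun r : RR => g (T (r * t) x))).
    have := integrableD measurableT iox ihx; apply: eq_integrable => // r _ /=.
    by rewrite -EFinD subrK.
  have := le_normr_Rintegral measurableT iox; rewrite RintegralB// => ab.
  have abE : (`|avg nu t g x - avg nu t h x|%:E <=
     \int[nu]_r (`|g (T (r * t) x) - h (T (r * t) x)|%:E))%E.
    apply: (@le_trans _ _ (\int[nu]_r `|g (T (r * t) x) - h (T (r * t) x)|)%:E).
      by rewrite lee_fin.
    by rewrite /Rintegral fineK// ge0_fin_numE// integral_ge0.
  apply: (@le_trans _ _ (`|avg nu t h x - \int[mu]_y h y|%:E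
      + `|avg nu t g x - avg nu t h x|%:E + (e / 3)%:E)%E); last first.
    by apply: leeD => //; apply: leeD.
  rewrite -!EFinD lee_fin.
  have key (a b c e1 : R) : a - b = (c - e1) + (a - c) - (b - e1) by ring.
  rewrite (key (avg nu t g x) (\int[mu]_y g y) (avg nu t h x) (\int[mu]_y h y)).
  by apply: le_trans (ler_normB _ _) _; apply: lerD; [exact: ler_normD|exact: igh].
have md := measurable_dev nu t mh.
have mdI := emeasurable_funD md mI.
have I0 x : (0 <= \int[nu]_r (`|g (T (r * t) x) - h (T (r * t) x)|%:E))%E by exact: integral_ge0.
pose F1 x := (`|avg nu t h x - \int[mu]_y h y|%:E).
pose F2 x := (\int[nu]_r (`|g (T (r * t) x) - h (T (r * t) x)|%:E))%E.
have F10 x : (0 <= F1 x)%E by rewrite lee_fin.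
have c0 (x : S) : [set: S] x -> (0 <= (e / 3)%:E)%E by rewrite lee_fin ltW.
rewrite (@ge0_integralD _ _ _ mu _ measurableT (fun x => F1 x + F2 x)%E (fun=> (e / 3)%:E))//.
- rewrite (@ge0_integralD _ _ _ mu _ measurableT F1 F2)//.
  rewrite integral_cst//= probability_setT mule1; apply: leeD => //.
  apply: leeD => //.
  by rewrite (integral_orbit nu t mgh (fun x => normr_ge0 (g x - h x))).
- by move=> x _; exact: I0.
- by move=> x _; apply: adde_ge0; [exact: F10|exact: I0].
Unshelve. all: by end_near. Qed.

End flow_averages.

(** * From a generating class of events to integrable functions *)

Section averaging_extension.
Import HBSimple.
Context {R : realType} d (S : measurableType d).
Variables (mu : probability S R) (T : R -> S -> S).
Hypothesis T_flow : mp_flow mu T.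
Notation RR := (measurableTypeR R).
Notation averaging := (averaging mu T).

Lemma nbhs0e_le (e : R) : 0 < e -> nbhs (0%E : \bar R) [set y : \bar R | (y <= e%:E)%E].
Proof.
move=> e0; have : nbhs (0%E : \bar R) [set y : \bar R | (y < e%:E)%E].
  by apply: open_nbhs_nbhs; split; [exact: open_ereal_lt_ereal|rewrite /= lte_fin].
by apply: filterS => y /ltW.
Qed.

Lemma bounded_mfun_indic (A : set S) : measurable A -> bounded_mfun (\1_A : S -> R).
Proof.
move=> mA; split; first exact: measurable_indic.
by exists 1 => x; rewrite indicE; case: (x \in A); rewrite ?normr1 ?normr0.
Qed.

Lemma averaging_ext (g h : S -> R) : g =1 h -> averaging g -> averaging h.
Proof. by move=> /funext ->. Qed.

Lemma averaging1 : averaging (\1_[set: S] : S -> R).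
Proof.
move=> nu anu e e0; apply: nearW => t; rewrite /deviation.
rewrite (_ : (\int[mu]_x _)%E = 0%E) ?lee_fin ?ltW//.
apply: integral0_eq => x _; rewrite /avg indicT /= !Rintegral_cst//=.
by rewrite !probability_setT/= subrr normr0.
Qed.

Lemma averagingC (A : set S) : measurable A -> averaging (\1_A) -> averaging (\1_(~` A)).
Proof.
move=> mA aA; have bA := bounded_mfun_indic mA.
have bT := bounded_mfun_indic measurableT.
have bN : bounded_mfun (fun x => -1 * \1_A x : R).
  case: bA => m1 [M hM]; split; first exact: measurable_funM.
  by exists M => x; rewrite normrM normrN normr1 mul1r.
apply: (@averaging_ext (fun x => \1_[set: S] x + -1 * \1_A x)).
  by move=> x; rewrite !indicE in_setT in_setC; case: (x \in A) => /=; lra.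
have aN := averagingZ T_flow (-1) bA aA.
exact: (averagingD T_flow bT bN averaging1 aN).
Qed.

Lemma averagingU (A B : set S) : measurable A -> measurable B -> A `&` B = set0 ->
  averaging (\1_A) -> averaging (\1_B) -> averaging (\1_(A `|` B)).
Proof.
move=> mA mB AB0 aA aB; apply: (@averaging_ext (fun x => \1_A x + \1_B x)).
  move=> x; rewrite !indicE in_setU; have [xA|] := boolP (x \in A); last by rewrite add0r.
  rewrite (_ : x \in B = false) ?addr0//; apply/negbTE/negP; rewrite inE => xB.
  by move: xA; rewrite inE => xA; have : (A `&` B) x by []; rewrite AB0.
exact: (averagingD T_flow (bounded_mfun_indic mA) (bounded_mfun_indic mB) aA aB).
Qed.

Lemma averaging_bigcup (F : (set S)^nat) : (forall n, measurable (F n)) ->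
  trivIset setT F -> (forall n, averaging (\1_(F n))) -> averaging (\1_(\bigcup_k F k)).
Proof.
move=> mF tF aF; have mU : measurable (\bigcup_k F k) by exact: bigcup_measurable.
pose U n := \big[setU/set0]_(k < n) F k.
have mUn n : measurable (U n) by apply: bigsetU_measurable => k _; exact: mF.
have aU n : averaging (\1_(U n)).
  elim: n => [|n IHn].
    rewrite /U big_ord0; apply: averaging_ext (averagingC measurableT averaging1).
    by move=> x; rewrite setCT.
  rewrite /U big_ord_recr /= -/(U n).
  apply: (averagingU (mUn n) (mF n) _ IHn (aF n)).
  apply/seteqP; split => // x [/=]; rewrite /U -(bigcup_mkord n) => -[k /= kn Fkx] Fnx.
  have kn' : k <> n by move=> kE; rewrite kE ltnn in kn.
  by move/trivIsetP : tF => /(_ k n I I (introN eqP kn')) /seteqP[h _]; exact: (h x).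
apply: averaging_approx => //; first exact/bounded_mfun_int/bounded_mfun_indic.
move=> e e0.
have cU : (mu (\bigcup_k F k) - mu (U n))%E @[n --> \oo] --> 0%E.
  rewrite -(@subee _ (mu (\bigcup_k F k))); last exact: fin_num_measure.
  apply: cvgeB => //; [|exact: cvg_cst|].
    by rewrite fin_num_adde_defr ?fin_num_measure.
  rewrite -[X in _ --> mu X](_ : \bigcup_n U n = \bigcup_k F k); last first.
    apply/seteqP; split => x.
      by move=> [n _]; rewrite /U -(bigcup_mkord n) => -[k _ Fkx]; exists k.
    by move=> [k _ Fkx]; exists k.+1 => //; rewrite /U -(bigcup_mkord k.+1); exists k => /=.
  apply: nondecreasing_cvg_mu => //; first exact: bigcup_measurable.
  by apply/nondecreasing_seqP => n; apply/subsetPset; rewrite /U big_ord_recr; exact: subsetUl.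
(* Finitely many of the sets carry all but e of the measure. *)
have [n nU] : exists n, (mu (\bigcup_k F k) - mu (U n) <= e%:E)%E.
  have /cU [n _ /(_ n (leqnn n)) ne] := nbhs0e_le e0.
  by exists n.
exists (\1_(U n)); split => //; first exact: bounded_mfun_indic.
have UF : U n `<=` \bigcup_k F k by rewrite /U -bigcup_mkord => x [k _ Fkx]; exists k.
rewrite (_ : (\int[mu]_x _)%E = mu (\bigcup_k F k `\` U n)).
  rewrite measureD//; last by rewrite ltey_eq fin_num_measure.
  by rewrite (setIidr UF).
rewrite -[X in _ = mu X]setIT -integral_indic//; last exact: measurableD.
apply: eq_integral => x _; rewrite !indicE in_setD.
have [xU|xU] := boolP (x \in U n).
  by rewrite (_ : x \in \bigcup_k F k)/= ?subrr ?normr0//; move: xU; rewrite !inE => /UF.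
by rewrite andbT subr0; case: (x \in \bigcup_k F k); rewrite ?normr1 ?normr0.
Qed.

(** The events with the averaging property form a Dynkin class. *)
Lemma averaging_generated (G : set (set S)) :
  @measurable _ S = <<s G >> -> setI_closed G ->
  (forall A, G A -> averaging (\1_A)) ->
  forall A, measurable A -> averaging (\1_A).
Proof.
move=> mG GI aG A; rewrite mG; move: A.
exact: (@dynkin_induction _ _ G (fun A => averaging (\1_A)) mG GI averaging1 aG
  averagingC averaging_bigcup).
Qed.

Lemma averaging_integrable : (forall A, measurable A -> averaging (\1_A)) ->
  forall g : S -> R, mu.-integrable setT (EFin \o g) -> averaging g.
Proof.
move=> aA g ig; apply: averaging_approx => // e e0.
have [g_ [ig_ _ cg]] := approximation_sfun_integrable measurableT ig.
have [n ge] : exists n, (\int[mu]_x `|(g x)%:E - (g_ n x)%:E| <= e%:E)%E.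
  have /cg [n _ /(_ n (leqnn n)) ne] := nbhs0e_le e0.
  by exists n.
exists (g_ n); split => //.
  split; first exact: measurable_funP.
  have [M [_ /= bM]] := simple_bounded (g_ n).
  by exists (M + 1) => x; apply: bM => //; rewrite ltrDl.
pose h (s : seq R) x : R := \sum_(y <- s) (y * \1_(g_ n @^-1` [set y]) x).
have my y : measurable (g_ n @^-1` [set y]) by [].
have bh s : bounded_mfun (h s) /\ averaging (h s).
  elim: s => [|y s [[mh [M hM]] ah]].
    rewrite (_ : h [::] = (fun x => 0 * \1_[set: S] x)); last first.
      by apply/funext => x; rewrite /h big_nil mul0r.
    have bT := bounded_mfun_indic measurableT.
    split; last by apply: averagingZ => //; exact: averaging1.
    split; first exact: measurable_funM.
    by exists 0 => x; rewrite mul0r normr0.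
  have bY : bounded_mfun (fun x => y * \1_(g_ n @^-1` [set y]) x).
    have [m1 [N hN]] := bounded_mfun_indic (my y).
    split; first exact: measurable_funM.
    by exists (`|y| * N) => x; rewrite normrM ler_wpM2l.
  rewrite (_ : h (y :: s) = (fun x => y * \1_(g_ n @^-1` [set y]) x + h s x)); last first.
    by apply/funext => x; rewrite /h big_cons.
  split; last first.
    have aY := averagingZ T_flow y (bounded_mfun_indic (my y)) (aA _ (my y)).
    by apply: (averagingD T_flow bY _ aY ah); split=> //; exists M.
  case: bY => m1 [N hN]; split; first exact: measurable_funD.
  by exists (N + M) => x; apply: le_trans (ler_normD _ _) _; exact: lerD.
have [_] := bh (finmap.enum_fset (fset_set (range (g_ n)))).
rewrite (_ : h _ = g_ n :> (S -> R))//; apply/funext => x.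
by rewrite /h fimfunE fsbig_finite//; exact: fimfunP.
Qed.

End averaging_extension.

(** * Averaging from independence at most times *)

Lemma integral_sections {R : realType} d1 d2 (T1 : measurableType d1) (T2 : measurableType d2)
    (m1 : {sigma_finite_measure set T1 -> \bar R})
    (m2 : {sigma_finite_measure set T2 -> \bar R}) (A : set (T1 * T2)) : measurable A ->
  (\int[m1]_x m2 (xsection A x) = \int[m2]_y m1 (ysection A y))%E.
Proof.
move=> mA; have := indic_fubini_tonelli m1 m2 mA.
by rewrite indic_fubini_tonelli_FE// indic_fubini_tonelli_GE.
Qed.

Section averaging_by_independence.
Context {R : realType} d (S : measurableType d).
Variables (mu : probability S R) (T : R -> S -> S).
Hypothesis T_flow : mp_flow mu T.
Notation RR := (measurableTypeR R).
Implicit Types (nu : probability RR R) (t : R).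

Definition sqprob nu : probability (RR * RR)%type R := (nu \x nu)%E.

Definition return_pairs (B : set R) t : set (RR * RR) :=
  [set z | B ((z.1 - z.2) * t)].

Definition thin (B : set R) : Prop := forall nu, atomless nu -> forall e : R, 0 < e ->
  \forall t \near +oo, (sqprob nu (return_pairs B t) <= e%:E)%E.

(** By Tonelli's theorem the left-hand side is the mean over (r, r') of the measure
    of the intersection of the preimages of E under T_(r t) and T_(r' t), which only
    depends on (r - r') t. *)
Lemma joint_return (E : set S) (B : set RR) (p : R) nu t :
  measurable E -> measurable B -> 0 <= p ->
  (forall s, ~ B s -> mu (T s @^-1` E `&` E) = p%:E) ->
  (\int[mu]_x (avg T nu t (\1_E) x ^+ 2)%:E <=
   p%:E + sqprob nu (return_pairs B t))%E.
Proof.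
move=> mE mB p0 EB.
pose W : set (S * (RR * RR)) := [set z | E (T (z.2.1 * t) z.1) /\ E (T (z.2.2 * t) z.1)].
set bad := return_pairs B t.
have mbad : measurable bad.
  rewrite -[bad]setTI.
  have : measurable_fun setT (fun z : RR * RR => (z.1 - z.2) * t : RR).
    apply: measurable_funM => //; apply: measurable_funB.
      exact: measurable_fst.
    exact: measurable_snd.
  by move=> /(_ measurableT B mB).
have mW : measurable W.
  have m1 : measurable_fun setT (fun z : S * (RR * RR) => T (z.2.1 * t) z.1).
    apply: (measurableT_comp (measurable_orbit T_flow t)
      (_ : measurable_fun setT (fun z : S * (RR * RR) => (z.1, z.2.1)))).
    apply/measurable_fun_pairP; split => /=; first exact: measurable_fst.
    exact: measurableT_comp measurable_fst measurable_snd.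
  have m2 : measurable_fun setT (fun z : S * (RR * RR) => T (z.2.2 * t) z.1).
    apply: (measurableT_comp (measurable_orbit T_flow t)
      (_ : measurable_fun setT (fun z : S * (RR * RR) => (z.1, z.2.2)))).
    apply/measurable_fun_pairP; split => /=; first exact: measurable_fst.
    exact: measurableT_comp measurable_snd measurable_snd.
  rewrite (_ : W = ([set: S * (RR * RR)] `&` (fun z => T (z.2.1 * t) z.1) @^-1` E) `&`
    ([set: S * (RR * RR)] `&` (fun z => T (z.2.2 * t) z.1) @^-1` E)).
    by apply: measurableI; [exact: m1|exact: m2].
  by rewrite !setTI.
have mo x : measurable [set r : RR | E (T (r * t) x)].
  by have := measurable_orbitr T_flow t x measurableT mE; rewrite setTI.
have -> : (\int[mu]_x (avg T nu t \1_E x ^+ 2)%:E = \int[mu]_x (sqprob nu (xsection W x)))%E.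
  apply: eq_integral => x _.
  rewrite (_ : xsection W x = [set r : RR | E (T (r * t) x)] `*` [set r : RR | E (T (r * t) x)]).
    rewrite /sqprob /= product_measure1E// expr2 EFinM.
    have -> : (avg T nu t \1_E x)%:E = nu [set r : RR | E (T (r * t) x)]; last by [].
    rewrite /avg /Rintegral (_ : (\int[nu]_r _)%E = nu [set r : RR | E (T (r * t) x)]).
      by rewrite fineK// fin_num_measure.
    by rewrite -[X in _ = nu X]setIT -integral_indic.
  by apply/seteqP; split => -[r1 r2]; rewrite /xsection/= inE.
rewrite (integral_sections mu (sqprob nu) mW).
apply: (@le_trans _ _ (\int[sqprob nu]_z (p%:E + (\1_bad z)%:E))%E).
  apply: ge0_le_integral => //=.
  - exact: measurable_fun_ysection.
  - by apply: emeasurable_funD => //; apply/measurable_EFinP; exact: measurable_indic.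
  move=> [r1 r2] _; rewrite /= (_ : ysection W (r1, r2) =
      T (r2 * t) @^-1` (T ((r1 - r2) * t) @^-1` E `&` E)); last first.
    apply/seteqP; split => x; rewrite /ysection/= inE/= /W/= mulrBl.
      by rewrite -(flowD T_flow) subrK.
    by rewrite -(flowD T_flow) subrK.
  have mTE : measurable (T ((r1 - r2) * t) @^-1` E).
    by have := measurable_flow T_flow ((r1 - r2) * t) measurableT mE; rewrite setTI.
  rewrite (flow_preserving T_flow); last exact: measurableI.
  rewrite indicE; have [zb|zb] := boolP ((r1, r2) \in bad).
    rewrite -EFinD; apply: (@le_trans _ _ 1%E).
      by apply: probability_le1; exact: measurableI.
    by rewrite lee_fin lerDr.
  by rewrite adde0 EB//; move: zb; rewrite notin_setE.
rewrite ge0_integralD//=; last by apply/measurable_EFinP; exact: measurable_indic.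
rewrite integral_cst//= probability_setT mule1 integral_indic// setIT.
exact: lexx.
Qed.

(** The variance of the average of the indicator of E is small, and the L1 norm is
    bounded by the inequality |y| <= e/2 + y^2 / (e/2). *)
Lemma averaging_indep (E : set S) (B : set RR) : measurable E -> measurable B ->
  thin B ->
  (forall s, ~ B s -> mu (T s @^-1` E `&` E) = (mu E * mu E)%E) ->
  averaging mu T (\1_E).
Proof.
move=> mE mB tB EB nu anu e e0.
pose p : R := fine (mu E); have pE : mu E = p%:E by rewrite fineK// fin_num_measure.
have p0 : 0 <= p by rewrite fine_ge0.
have d0 : 0 < e / 2 by rewrite divr_gt0.
have e20 : 0 < e / 2 * (e / 2) by rewrite mulr_gt0.
have EB' s : ~ B s -> mu (T s @^-1` E `&` E) = (p * p)%:E by move=> /EB ->; rewrite pE.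
near=> t.
have Bt : (sqprob nu (return_pairs B t) <= (e / 2 * (e / 2))%:E)%E by near: t; exact: tB.
have G2 := joint_return nu t mE mB (mulr_ge0 p0 p0) EB'.
have m1 : measurable_fun setT (\1_E : S -> R) by exact: measurable_indic.
have mG := measurable_avg T_flow nu t m1.
set G := avg T nu t \1_E in G2 mG *.
have G0 x : 0 <= G x by apply: Rintegral_ge0 => r _; rewrite indicE.
have GE x : (G x)%:E = (\int[nu]_r (\1_E (T (r * t) x))%:E)%E.
  rewrite /G /avg /Rintegral fineK//.
  exact: integrable_fin_num (bounded_mfun_orbit_int T_flow nu t x (bounded_mfun_indic mE)).
have IG : (\int[mu]_x (G x)%:E = p%:E)%E.
  under eq_integral do rewrite GE.
  rewrite (integral_orbit T_flow nu t (k := fun x => (\1_E x)%:E))//.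
  - by rewrite integral_indic// setIT.
  - exact/measurable_EFinP.
have I1 : (\int[mu]_y \1_E y)%R = p by rewrite /Rintegral integral_indic// setIT.
rewrite /deviation I1 -/G.
pose i : R := (e / 2)^-1; have i0 : 0 < i by rewrite invr_gt0.
have id1 : i * (e / 2) = 1 by rewrite mulVf// gt_eqF.
pose c : R := 2 * p * i.
have c0 : 0 <= c by rewrite !mulr_ge0// ltW.
have k0 : 0 <= e / 2 + p * p / (e / 2) by apply: addr_ge0; [exact: ltW|rewrite divr_ge0 ?mulr_ge0// ltW].
have mD : measurable_fun setT (fun x => `|G x - p|%:E).
  by apply/measurable_EFinP; apply: measurableT_comp => //; exact: measurable_funB.
have mGE : measurable_fun setT (fun x => (G x)%:E) by exact/measurable_EFinP.
have mG2 : measurable_fun setT (fun x => (G x ^+ 2)%:E).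
  by apply/measurable_EFinP; exact: measurable_funX.
have mcG : measurable_fun setT (fun x => c%:E * (G x)%:E)%E by exact: measurable_funeM.
have miG : measurable_fun setT (fun x => i%:E * (G x ^+ 2)%:E)%E by exact: measurable_funeM.
have cG0 x : (0 <= c%:E * (G x)%:E)%E by rewrite -EFinM lee_fin mulr_ge0.
have GE0 (x : S) : [set: S] x -> (0 <= (G x)%:E)%E by rewrite lee_fin.
have cE0 : (0 <= c%:E)%E by rewrite lee_fin.
have iG0 x : (0 <= i%:E * (G x ^+ 2)%:E)%E.
  by rewrite -EFinM lee_fin mulr_ge0 ?sqr_ge0// ltW.
have k0' (x : S) : (0 <= (e / 2 + p * p / (e / 2))%:E)%E by rewrite lee_fin.
(* The term linear in G is kept on the left so that all integrands are nonnegative. *)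
have key : (\int[mu]_x `|G x - p|%:E + (c * p)%:E <=
   (e / 2 + p * p / (e / 2))%:E + (i * (p * p + e / 2 * (e / 2)))%:E)%E.
  apply: (@le_trans _ _ (\int[mu]_x (`|G x - p|%:E + c%:E * (G x)%:E))%E).
    rewrite (@ge0_integralD _ _ _ mu _ measurableT (fun x => `|G x - p|%:E)
      (fun x => c%:E * (G x)%:E)%E)//.
    have -> : (\int[mu]_x (c%:E * (G x)%:E) = c%:E * p%:E)%E by rewrite ge0_integralZl ?IG.
    by rewrite EFinM.
  apply: (@le_trans _ _ (\int[mu]_x ((e / 2 + p * p / (e / 2))%:E +
      i%:E * (G x ^+ 2)%:E))%E).
    apply: ge0_le_integral => //.
    - by move=> x _; apply: adde_ge0.
    - exact: emeasurable_funD.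
    - exact: emeasurable_funD.
    move=> x _; rewrite -!EFinM -!EFinD lee_fin /c -/i -subr_ge0.
    have -> : e / 2 + p * p * i + i * G x ^+ 2 - (`|G x - p| + 2 * p * i * G x) =
       i * (G x - p) ^+ 2 + (i * (e / 2)) * (e / 2) - `|G x - p| * (i * (e / 2)).
      by rewrite id1; ring.
    have -> : (G x - p) ^+ 2 = `|G x - p| ^+ 2 by rewrite real_normK ?num_real.
    set a := `|G x - p|.
    have -> : i * a ^+ 2 + i * (e / 2) * (e / 2) - a * (i * (e / 2)) =
      i * ((a - e / 4) ^+ 2 + 3 * (e / 4) ^+ 2) by field.
    apply: mulr_ge0; first exact: ltW.
    by apply: addr_ge0; [exact: sqr_ge0|apply: mulr_ge0 => //; exact: sqr_ge0].
  rewrite (@ge0_integralD _ _ _ mu _ measurableT (fun=> (e / 2 + p * p / (e / 2))%:E)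
    (fun x => i%:E * (G x ^+ 2)%:E)%E)//.
  rewrite integral_cst//= probability_setT mule1; apply: leeD => //.
  rewrite ge0_integralZl//; last by rewrite lee_fin ltW.
  - rewrite EFinM; apply: lee_wpmul2l; first by rewrite lee_fin ltW.
    by apply: le_trans G2 _; rewrite EFinD; apply: leeD.
  - by move=> x _; rewrite lee_fin sqr_ge0.
have -> : e%:E = ((e / 2 + p * p / (e / 2))%:E + (i * (p * p + e / 2 * (e / 2)))%:E
    - (c * p)%:E)%E.
  rewrite -EFinN -!EFinD; congr EFin; rewrite -/i /c.
  transitivity (e / 2 + (i * (e / 2)) * (e / 2)); last by ring.
  by rewrite id1 mul1r -splitr.
by rewrite leeBrDr.
Unshelve. all: by end_near. Qed.

End averaging_by_independence.

(** * The recurrence times are thin *)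

Section recurrence_is_thin.
Context {R : realType}.
Notation RR := (measurableTypeR R).
Implicit Types (nu : probability RR R).

Let measurable_diff : measurable_fun setT (fun z : RR * RR => z.1 - z.2 : RR).
Proof. by apply: measurable_funB; [exact: measurable_fst|exact: measurable_snd]. Qed.

Lemma sqprobE nu (A : set (RR * RR)) :
  sqprob nu A = (\int[nu]_x nu (xsection A x))%E.
Proof. by []. Qed.

Lemma sqprobX nu (A B : set RR) : measurable A -> measurable B ->
  sqprob nu (A `*` B) = (nu A * nu B)%E.
Proof. by move=> mA mB; exact: product_measure1E. Qed.

(** The square of a short interval lies in a thin neighbourhood of the diagonal,
    and the diagonal is negligible for nu x nu. *)
Lemma atomless_small_intervals nu : atomless nu -> forall e : R, 0 < e ->
  exists2 z : R, 0 < z & forall x : R, (nu `[(x - z)%R, (x + z)%R]%classic <= e%:E)%E.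
Proof.
move=> anu e e0.
pose D (n : nat) : set (RR * RR) := [set z | `|z.1 - z.2| <= n.+1%:R^-1].
have mD n : measurable (D n).
  have := measurable_diff measurableT (measurable_itv `[- n.+1%:R^-1, n.+1%:R^-1]).
  rewrite setTI; congr (measurable _).
  by apply/seteqP; split => z /=; rewrite /D/= in_itv/= ler_norml.
have mI : measurable (\bigcap_n D n) by exact: bigcapT_measurable_count.
have D0 : sqprob nu (\bigcap_n D n) = 0%E.
  rewrite sqprobE; apply: integral0_eq => x _.
  rewrite (_ : xsection _ x = [set x]); first exact: anu.
  apply/seteqP; split => y; rewrite /xsection/= inE; last first.
    by move=> -> n _; rewrite /D/= subrr normr0.
  move=> h; apply/eqP; rewrite -subr_eq0 -normr_eq0 distrC eq_le normr_ge0 andbT.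
  apply/ler_addgt0Pl => d d0; rewrite addr0.
  pose n := Num.bound d^-1; have := h n I; rewrite /D/= => xy; apply: le_trans xy _.
  have dn : d^-1 < n%:R by apply: archi_boundP; rewrite invr_ge0 ltW.
  rewrite -[leRHS]invrK lef_pV2 ?posrE ?invr_gt0//.
  by apply: le_trans (ltW dn) _; rewrite ler_nat.
have cD : sqprob nu (D n) @[n --> \oo] --> 0%E.
  rewrite -D0; apply: nonincreasing_cvg_mu => //.
    by apply: le_lt_trans (probability_le1 _ (mD 0%N)) _; rewrite ltry.
  apply/nonincreasing_seqP => n; apply/subsetPset => z; rewrite /D/= => h.
  by apply: le_trans h _; rewrite lef_pV2 ?posrE// ler_nat.
have ee0 : 0 < e * e / 2 by rewrite divr_gt0 ?mulr_gt0.
have /cD [n _ /(_ n (leqnn n)) Dn] := nbhs0e_le ee0.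
exists (n.+1%:R^-1 / 2); first by rewrite divr_gt0.
move=> x; rewrite leNgt; apply/negP => eI.
set I := (X in nu X) in eI; have mIx : measurable I by exact: measurable_itv.
have : (nu I * nu I <= (e * e / 2)%:E)%E.
  rewrite -sqprobX//; apply: le_trans Dn; apply: le_measure; rewrite ?inE//.
    exact: measurableX.
  move=> [y1 y2] []; rewrite /I/D/= !in_itv/= ler_norml.
  by move: (n.+1%:R^-1 : R) => i /andP[? ?] /andP[? ?]; apply/andP; split; lra.
have : (e%:E * e%:E < nu I * nu I)%E by apply: lte_pmul; rewrite ?lee_fin ?ltW.
move=> /lt_le_trans/[apply]; rewrite -EFinM lte_fin.
have : 0 < e * e by rewrite mulr_gt0.
by lra.
Qed.

Lemma probability_tail nu (e : R) : 0 < e ->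
  exists2 M : R, 0 < M & (nu [set r : R | (M < `|r|)%R] <= e%:E)%E.
Proof.
move=> e0; pose D (n : nat) : set RR := [set r | n.+1%:R < `|r|].
have mD n : measurable (D n).
  rewrite (_ : D n = ~` `[- n.+1%:R, n.+1%:R]%classic).
    by apply: measurableC; exact: measurable_itv.
  by apply/seteqP; split => r /=; rewrite /D/= in_itv/= -ler_norml ltNge => /negP.
have cD : nu (D n) @[n --> \oo] --> 0%E.
  rewrite -(measure0 nu) (_ : set0 = \bigcap_n D n).
    apply: nonincreasing_cvg_mu => //.
    - by apply: le_lt_trans (probability_le1 _ (mD 0%N)) _; rewrite ltry.
    - exact: bigcapT_measurable_count.
    apply/nonincreasing_seqP => n; apply/subsetPset => r; rewrite /D/=.
    by apply: lt_trans; rewrite ltr_nat.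
  apply/seteqP; split => // r h.
  have := h (Num.bound `|r|) I; rewrite /D/=.
  have := archi_boundP (normr_ge0 r) => h1 h2.
  by have := lt_trans h2 h1; rewrite ltr_nat ltnNge leqnSn.
have /cD [n _ /(_ n (leqnn n)) Dn] := nbhs0e_le e0.
by exists n.+1%:R.
Qed.

(** Two different gaps cannot both be felt: the larger of the two exceptional
    windows would have a half-width of order at least z t, whereas d t <= 2 M t forces its
    gap to be at most of order t, and its half-width is a small fraction of its
    gap. *)
Lemma recurrent_window (K z M : R) : 0 <= K -> 0 < z -> 0 < M ->
  \forall t \near +oo, exists c : R, forall d : R, 0 <= d -> d <= 2 * M ->
    recurrent K (d * t) -> d <= z \/ `|d - c| <= z.
Proof.
move=> K0 z0 M0.
(* Beyond rank N, the window of a gap that is felt has half-width at most z t. *)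
have [N NP] : exists N : nat, 2 * (2 * M + 1) / z < N%:R.
  exists (Num.bound (2 * (2 * M + 1) / z)); apply: archi_boundP.
  by rewrite divr_ge0 ?ltW// mulr_gt0// ltr_wpDr// mulr_gt0.
have {}NP : 2 * (2 * M + 1) < N%:R * z by rewrite -ltr_pdivrMr.
have span_mono m n : (m <= n)%N -> gapspan m <= gapspan n :> R.
  move=> /subnK <-; elim: (n - m)%N => [|k IHk]; first by rewrite add0n.
  by rewrite addSn; apply: le_trans IHk _; rewrite gapspanS lerDl.
near=> t.
have t0 : 0 < t by near: t; apply: nbhs_pinfty_gt; exact: num_real.
have tK : 2 * K <= z * t.
  rewrite -ler_pdivrMl// mulrC; near: t; apply: nbhs_pinfty_ge; exact: num_real.
have t1K : K <= t by near: t; apply: nbhs_pinfty_ge; exact: num_real.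
have tN : gap N + gapspan N + K < z * t.
  rewrite -ltr_pdivrMl//; near: t; apply: nbhs_pinfty_gt; exact: num_real.
have win m d : z < d -> d <= 2 * M -> `| `|d * t| - gap m| <= gapspan m + K ->
   [/\ gapspan m <= z * t / 2, z * t < gap m + gapspan m + K & `|d - gap m / t| <= z].
  move=> zd dM; have dt0 : 0 <= d * t by rewrite mulr_ge0 ?(ltW t0)// ltW// (lt_trans z0).
  rewrite (ger0_norm dt0) => dm; have := dm; rewrite ler_norml => /andP[d1 d2].
  have ztd : z * t < d * t by rewrite ltr_pM2r.
  have dtM : d * t <= 2 * M * t by rewrite ler_pM2r.
  have ztm : z * t < gap m + gapspan m + K by lra.
  have Nm : (N < m)%N.
    rewrite ltnNge; apply/negP => mN.
    have := span_mono _ _ (mN : m.+1 <= N.+1)%N; rewrite !gapspanS; lra.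
  have sm : m.+1%:R * gapspan m <= (2 * M + 1) * t.
    have : gap m = m.+1%:R * gapspan m + gapspan m + 2 * m.+2%:R :> R.
      by rewrite gapE -[m.+2]addn1 natrD; ring.
    have : 0 <= m.+2%:R :> R by [].
    by lra.
  have sz : gapspan m <= z * t / 2.
    rewrite -(@ler_pM2l _ m.+1%:R)//; apply: le_trans sm _.
    have : N%:R * (z * t) <= m.+1%:R * (z * t).
      by rewrite ler_pM2r ?mulr_gt0// ler_nat ltnW// ltnW.
    have : 2 * (2 * M + 1) * t < N%:R * z * t by rewrite ltr_pM2r.
    by lra.
  split => //; rewrite -(@ler_pM2r _ t)//.
  rewrite -[X in _ * X <= _](gtr0_norm t0) -normrM mulrBl divfK ?gt_eqF//.
  by apply: le_trans dm _; lra.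
have [[d0 [m [zd0 d0M md0]]]|none] := pselect (exists d m, [/\ z < d, d <= 2 * M &
    `| `|d * t| - gap m| <= gapspan m + K]); last first.
  exists 0 => d dge dM rec; left; rewrite leNgt; apply/negP => zd.
  case: rec => [|[m dm]]; last by apply: none; exists d, m.
  rewrite ger0_norm; last by rewrite mulr_ge0// ltW.
  have : z * t < d * t by rewrite ltr_pM2r.
  have : 0 < z * t by rewrite mulr_gt0.
  by lra.
exists (gap m / t) => d dge dM rec.
have [dz|zd] := leP d z; first by left.
right; case: rec => [|[m' dm']].
  rewrite ger0_norm; last by rewrite mulr_ge0// ltW.
  have : z * t < d * t by rewrite ltr_pM2r.
  have : 0 < z * t by rewrite mulr_gt0.
  by lra.
have [sm zm _] := win _ _ zd0 d0M md0.
have [sm' zm' dE] := win _ _ zd dM dm'.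
have [mm|mm|->//] := ltngtP m m'.
  by have := span_mono _ _ mm; rewrite gapspanS; lra.
by have := span_mono _ _ mm; rewrite gapspanS; lra.
Unshelve. all: by end_near. Qed.

Lemma measurable_recurrent (K : R) : measurable (recurrent K : set RR).
Proof.
rewrite (_ : recurrent K = `[- K, K]%classic `|` \bigcup_m
   ((fun t : RR => `|t| : RR) @^-1` `[gap m - (gapspan m + K), gap m + (gapspan m + K)])).
  apply: measurableU; first exact: measurable_itv.
  apply: bigcupT_measurable => m; rewrite -[X in measurable X]setTI.
  by apply: (@normr_measurable R setT) => //; exact: measurable_itv.
apply/seteqP; split => t.
  move=> [tK|[m tm]]; [left|right]; first by rewrite /= in_itv/= -ler_norml.
  by exists m => //=; rewrite in_itv/= -ler_distl.
move=> [|[m _]]; rewrite /= in_itv/=; first by rewrite -ler_norml; left.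
by rewrite -ler_distl => tm; right; exists m.
Qed.

(** For fixed r, the exceptional r' lie in three intervals of half-length z, around
    r and around r - c and r + c. *)
Lemma thin_recurrent (K : R) : 0 <= K -> thin (recurrent K).
Proof.
move=> K0 nu anu e e0; have e50 : 0 < e / 5 by rewrite divr_gt0.
have [M M0 nM] := probability_tail nu e50.
have [z z0 nz] := atomless_small_intervals anu e50.
near=> t.
have [c cP] : exists c : R, forall d : R, 0 <= d -> d <= 2 * M ->
    recurrent K (d * t) -> d <= z \/ `|d - c| <= z.
  by near: t; exact: recurrent_window.
pose tail : set RR := [set r | M < `|r|].
have mtail : measurable tail.
  rewrite (_ : tail = ~` `[- M, M]%classic).
    by apply: measurableC; exact: measurable_itv.
  by apply/seteqP; split => r /=; rewrite /tail/= in_itv/= -ler_norml ltNge => /negP.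
pose C : set (RR * RR) := [set y | `|y.1 - y.2| <= z \/
   (`|y.1 - y.2 - c| <= z \/ `|y.1 - y.2 + c| <= z)].
have mC : measurable C.
  have m1 (a : R) : measurable [set y : RR * RR | `|y.1 - y.2 - a| <= z].
    have := measurable_diff measurableT (measurable_itv `[a - z, a + z]).
    rewrite setTI; congr (measurable _).
    by apply/seteqP; split => y /=; rewrite in_itv/= -ler_distl.
  rewrite (_ : C = [set y | `|y.1 - y.2 - 0| <= z] `|` ([set y | `|y.1 - y.2 - c| <= z]
     `|` [set y | `|y.1 - y.2 - (- c)| <= z])).
    by apply: measurableU => //; exact: measurableU.
  by apply/seteqP; split => y; rewrite /C/setU/= subr0 opprK.
have sub : return_pairs (recurrent K) t `<=` tail `*` setT `|` (setT `*` tail `|` C).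
  move=> [r1 r2]; rewrite /return_pairs/= => rec.
  have [r1M|r1M] := ltP M `|r1|; first by left.
  have [r2M|r2M] := ltP M `|r2|; first by right; left.
  right; right; rewrite /C/=.
  have dM : `|r1 - r2| <= 2 * M by apply: le_trans (ler_normB _ _) _; lra.
  have : recurrent K (`|r1 - r2| * t).
    case: rec => [|[m]]; rewrite normrM => h; [left|right; exists m];
    by rewrite normrM normr_id.
  move=> /(cP _ (normr_ge0 _) dM) [|]; first by left.
  have [r0|r0] := leP 0 (r1 - r2); first by rewrite (ger0_norm r0) => h; right; left.
  by rewrite (ltr0_norm r0) => h; right; right; rewrite -normrN opprD.
have nC : (sqprob nu C <= (e / 5 + e / 5 + e / 5)%:E)%E.
  rewrite sqprobE; apply: (@le_trans _ _ (\int[nu]_x (e / 5 + e / 5 + e / 5)%:E)%E); last first.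
    by rewrite integral_cst//= probability_setT mule1.
  apply: ge0_le_integral => //=.
    exact: measurable_fun_xsection.
  move=> x _.
  pose I y := `[(y - z)%R, (y + z)%R]%classic : set RR.
  have mI y : measurable (I y) by exact: measurable_itv.
  apply: (@le_trans _ _ (nu (I x `|` I (x - c) `|` I (x + c)))).
    apply: le_measure; rewrite ?inE.
    - exact: measurable_xsection.
    - by apply: measurableU => //; exact: measurableU.
    move=> y; rewrite /xsection/= inE /C /I/= !in_itv/= -!ler_distl.
    case=> [h|[h|h]]; [left; left|left; right|right]; rewrite distrC.
    - by [].
    - by rewrite addrAC.
    - by rewrite addrAC.
  apply: le_trans (measureU2 _ _ _) _ => //; first exact: measurableU.
  rewrite !EFinD; apply: leeD; last exact: nz.
  by apply: le_trans (measureU2 _ _ _) _ => //; apply: leeD; exact: nz.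
have mrec : measurable (return_pairs (recurrent K) t).
  have : measurable_fun setT (fun y : RR * RR => (y.1 - y.2) * t : RR).
    by apply: measurable_funM.
  by move=> /(_ measurableT _ (measurable_recurrent K)); rewrite setTI.
have mT1 : measurable (tail `*` [set: RR]) by exact: measurableX.
have mT2 : measurable ([set: RR] `*` tail) by exact: measurableX.
apply: (@le_trans _ _ (sqprob nu (tail `*` setT `|` (setT `*` tail `|` C)))).
  by apply: le_measure; rewrite ?inE//; apply: measurableU => //; exact: measurableU.
have -> : e%:E = ((e / 5)%:E + ((e / 5)%:E + (e / 5 + e / 5 + e / 5)%:E))%E.
  by rewrite -!EFinD; congr EFin; lra.
apply: le_trans (measureU2 _ _ _) _ => //; first exact: measurableU.
apply: leeD.
  by rewrite [leLHS]sqprobX// probability_setT mule1.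
apply: le_trans (measureU2 _ _ _) _ => //; apply: leeD => //.
by rewrite [leLHS]sqprobX// probability_setT mul1e.
Unshelve. all: by end_near. Qed.

End recurrence_is_thin.

(** * Almost mixing *)

Section averaging_consequences.
Context {R : realType} d (S : measurableType d).
Variables (mu : probability S R) (T : R -> S -> S).
Hypothesis T_flow : mp_flow mu T.
Hypothesis T_avg : forall A : set S, measurable A -> averaging mu T (\1_A).
Notation RR := (measurableTypeR R).

Lemma atomless_unit_prob : atomless (@unit_prob R : probability RR R).
Proof.
move=> r; apply/eqP; rewrite eq_le measure_ge0 andbT.
rewrite -(lebesgue_measure_set1 r) /unit_prob/= /mrestr.
by apply: le_measure; rewrite ?inE//; apply: measurableI.
Qed.

(** Averages of an invariant indicator do not move, so the indicator is almost
    everywhere equal to its mean. Any atomless nu would do. *)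
Lemma averaging_ergodic : ergodic mu T.
Proof.
move=> A mA TA; pose p := fine (mu A).
have pE : mu A = p%:E by rewrite fineK// fin_num_measure.
have p0 : 0 <= p by rewrite fine_ge0.
have p1 : p <= 1 by rewrite -lee_fin -pE probability_le1.
suff : p * (1 - p) <= 0.
  move=> pp; have : p * (1 - p) = 0.
    by apply/eqP; rewrite eq_le pp mulr_ge0// subr_ge0.
  move=> /eqP; rewrite mulf_eq0 subr_eq0 => /orP[/eqP p00|/eqP p11].
    by left; rewrite pE p00.
  by right; rewrite pE -p11.
apply/ler_addgt0Pl => e e0; rewrite addr0.
have m1 : measurable_fun setT (\1_A : S -> R) by exact: measurable_indic.
near (+oo : set_system R) => t.
pose nu : probability RR R := unit_prob.
have dev : (deviation mu T nu t (\1_A) <= e%:E)%E.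
  by near: t; exact: (T_avg mA atomless_unit_prob e0).
pose W : set (S * RR) := [set z | A z.1 /\ ~ A (T (z.2 * t) z.1)].
have mTA : measurable [set z : S * RR | A (T (z.2 * t) z.1)].
  by have := measurable_orbit T_flow t measurableT mA; rewrite setTI.
have mW : measurable W.
  have mA1 : measurable [set z : S * RR | A z.1].
    by rewrite -[X in measurable X]setTI; exact: measurable_fst.
  by apply: measurableI => //; exact: measurableC.
have W0 : (\int[mu]_x nu (xsection W x) = 0)%E.
  rewrite integral_sections//; apply: integral0_eq => r _.
  apply/eqP; rewrite eq_le measure_ge0 andbT -(TA (r * t)).
  have mT : measurable (T (r * t) @^-1` A).
    by have := measurable_flow T_flow (r * t) measurableT mA; rewrite setTI.
  apply: le_measure; rewrite ?inE.
  - exact: measurable_ysection.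
  - by apply: measurableU; exact: measurableD.
  - by move=> x; rewrite /ysection/= inE => -[Ax nA]; right.
have I1 : (\int[mu]_y \1_A y)%R = p by rewrite /Rintegral integral_indic// setIT.
have mD : measurable_fun setT (fun x => `|avg T nu t \1_A x - p|%:E).
  apply/measurable_EFinP; apply: measurableT_comp => //.
  by apply: measurable_funB => //; exact: (measurable_avg T_flow).
have mX : measurable_fun setT (fun x => nu (xsection W x)) by exact: measurable_fun_xsection.
(* On A, the average is 1 minus the proportion of r for which x has left A. *)
have pt x : (((1 - p) * \1_A x)%:E <= `|avg T nu t \1_A x - p|%:E + nu (xsection W x))%E.
  rewrite indicE; have [xA|xA] := boolP (x \in A); last first.
    by rewrite mulr0 adde_ge0// lee_fin.
  have mo : measurable [set r : RR | A (T (r * t) x)].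
    by have := measurable_orbitr T_flow t x measurableT mA; rewrite setTI.
  have -> : xsection W x = ~` [set r : RR | A (T (r * t) x)].
    apply/seteqP; split => r; rewrite /xsection/= inE; first by case.
    by move=> nA; split => //; rewrite inE in xA.
  rewrite probability_setC//.
  have aE : nu [set r : RR | A (T (r * t) x)] = (avg T nu t \1_A x)%:E.
    rewrite /avg /Rintegral (_ : (\int[nu]_r _)%E = nu [set r : RR | A (T (r * t) x)]).
      by rewrite fineK// fin_num_measure.
    by rewrite -[X in _ = nu X]setIT -integral_indic.
  rewrite aE -EFinB -EFinD lee_fin mulr1.
  have := ler_norm (avg T nu t \1_A x - p); lra.
rewrite -lee_fin.
apply: (@le_trans _ _ (\int[mu]_x (`|avg T nu t \1_A x - p|%:E + nu (xsection W x)))%E).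
  apply: (@le_trans _ _ (\int[mu]_x ((1 - p)%:E * (\1_A x)%:E))%E).
    have mi1 : measurable_fun setT (fun x => (\1_A x : R)%:E) by exact/measurable_EFinP.
    have p10 : (0 <= (1 - p)%:E)%E by rewrite lee_fin subr_ge0.
    have i0 (x : S) : [set: S] x -> (0 <= (\1_A x : R)%:E)%E by rewrite lee_fin.
    have iA : (\int[mu]_x (\1_A x)%:E = p%:E)%E by rewrite integral_indic// setIT -pE.
    by rewrite (ge0_integralZl _ measurableT mi1 i0 p10) iA -EFinM mulrC.
  apply: ge0_le_integral => //=.
  - by move=> x _; rewrite -EFinM lee_fin mulr_ge0 ?subr_ge0.
  - by apply: measurable_funeM; exact/measurable_EFinP.
  - exact: emeasurable_funD.
  - by move=> x _; rewrite -EFinM; exact: pt.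
rewrite (@ge0_integralD _ _ _ mu _ measurableT (fun x => `|avg T nu t \1_A x - p|%:E)
   (fun x => nu (xsection W x)))//.
by rewrite W0 adde0; move: dev; rewrite /deviation I1.
Unshelve. all: by end_near. Qed.

Lemma normc_le_ReIm (z : R[i]) : Normc.normc z <= `|complex.Re z| + `|complex.Im z|.
Proof.
case: z => a b /=; rewrite -(@ler_pXn2r _ 2)// ?nnegrE ?sqrtr_ge0 ?addr_ge0//.
rewrite sqr_sqrtr ?addr_ge0 ?sqr_ge0// sqrrD !real_normK ?num_real//.
by rewrite addrAC lerDl mulrn_wge0// mulr_ge0.
Qed.

Lemma Re_le_normc (z : R[i]) : `|complex.Re z| <= Normc.normc z.
Proof.
case: z => a b /=; rewrite -(@ler_pXn2r _ 2)// ?nnegrE ?sqrtr_ge0//.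
by rewrite sqr_sqrtr ?addr_ge0 ?sqr_ge0// real_normK ?num_real// lerDl sqr_ge0.
Qed.

Lemma Im_le_normc (z : R[i]) : `|complex.Im z| <= Normc.normc z.
Proof.
case: z => a b /=; rewrite -(@ler_pXn2r _ 2)// ?nnegrE ?sqrtr_ge0//.
by rewrite sqr_sqrtr ?addr_ge0 ?sqr_ge0// real_normK ?num_real// lerDr sqr_ge0.
Qed.

Lemma measurable_normc d' (S' : measurableType d') (f : S' -> R[i]) :
  measurable_fun setT (fun x => complex.Re (f x)) ->
  measurable_fun setT (fun x => complex.Im (f x)) ->
  measurable_fun setT (fun x => Normc.normc (f x)).
Proof.
move=> mr mi.
rewrite (_ : (fun x => _) = fun x => Num.sqrt (complex.Re (f x) ^+ 2 + complex.Im (f x) ^+ 2)).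
  apply: (measurableT_comp (f := @Num.sqrt R)).
    by apply: continuous_measurable_fun; exact: sqrt_continuous.
  by apply: measurable_funD; exact: measurable_funX.
by apply/funext => x; case: (f x).
Qed.

Lemma averaging_almost_mixing : almost_mixing mu T.
Proof.
split; first exact: averaging_ergodic.
move=> nu anu f [mr mi]; rewrite /Lpnorm Lnorm1 => fi.
have mn := measurable_normc mr mi.
have nE x : (`|(EFin \o (Normc.normc (R:=R) \o f)) x|)%E = (Normc.normc (f x))%:E.
  by rewrite /= ger0_norm// (le_trans (normr_ge0 _) (Re_le_normc _)).
have ir : mu.-integrable setT (EFin \o (fun x => complex.Re (f x))).
  apply/integrableP; split; first exact/measurable_EFinP.
  apply: le_lt_trans fi; apply: ge0_le_integral => //=.
  - by apply/measurable_EFinP; exact: measurableT_comp.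
  - by apply/measurable_EFinP; exact: measurableT_comp.
  by move=> x _; rewrite [leRHS]nE lee_fin Re_le_normc.
have ii : mu.-integrable setT (EFin \o (fun x => complex.Im (f x))).
  apply/integrableP; split; first exact/measurable_EFinP.
  apply: le_lt_trans fi; apply: ge0_le_integral => //=.
  - by apply/measurable_EFinP; exact: measurableT_comp.
  - by apply/measurable_EFinP; exact: measurableT_comp.
  by move=> x _; rewrite [leRHS]nE lee_fin Im_le_normc.
have ar := averaging_integrable T_flow T_avg ir.
have ai := averaging_integrable T_flow T_avg ii.
have bound t : (Lpnorm mu 1 (fun x => (cintegral nu (fun r => f (T (r * t) x)) - cintegral mu f)%R)
   <= deviation mu T nu t (fun x => complex.Re (f x)) +
      deviation mu T nu t (fun x => complex.Im (f x)))%E.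
  rewrite /Lpnorm Lnorm1 /deviation.
  have mdr : measurable_fun setT (fun x => avg T nu t (fun x => complex.Re (f x)) x -
      \int[mu]_y complex.Re (f y)).
    by apply: measurable_funB => //; exact: (measurable_avg T_flow).
  have mdi : measurable_fun setT (fun x => avg T nu t (fun x => complex.Im (f x)) x -
      \int[mu]_y complex.Im (f y)).
    by apply: measurable_funB => //; exact: (measurable_avg T_flow).
  have mar : measurable_fun setT (fun x => `|avg T nu t (fun x => complex.Re (f x)) x -
      \int[mu]_y complex.Re (f y)|%:E).
    by apply/measurable_EFinP; exact: measurableT_comp.
  have mai : measurable_fun setT (fun x => `|avg T nu t (fun x => complex.Im (f x)) x -
      \int[mu]_y complex.Im (f y)|%:E).
    by apply/measurable_EFinP; exact: measurableT_comp.
  rewrite -ge0_integralD//; apply: ge0_le_integral => //=.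
  - apply/measurable_EFinP; apply: measurableT_comp => //.
    exact: (@measurable_normc _ S
      (fun x => cintegral nu (fun r => f (T (r * t) x)) - cintegral mu f)).
  - exact: emeasurable_funD.
  move=> x _; rewrite -EFinD lee_fin ger0_norm.
    exact: (normc_le_ReIm (cintegral nu (fun r => f (T (r * t) x)) - cintegral mu f)).
  exact: le_trans (normr_ge0 _)
    (Re_le_normc (cintegral nu (fun r => f (T (r * t) x)) - cintegral mu f)).
have ar' (e : R) : 0 < e -> \forall t \near +oo,
    (deviation mu T nu t (fun x => complex.Re (f x)) <= e%:E)%E := ar nu anu e.
have ai' (e : R) : 0 < e -> \forall t \near +oo,
    (deviation mu T nu t (fun x => complex.Im (f x)) <= e%:E)%E := ai nu anu e.
apply/fine_cvgP; split.
  apply: filterS2 (ar' 1 ltr01) (ai' 1 ltr01) => t dr di.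
  rewrite ge0_fin_numE ?Lnorm_ge0//; apply: le_lt_trans (bound t) _.
  by apply: le_lt_trans (leeD dr di) _; rewrite -EFinD ltry.
apply/(@cvgrPdist_le _ R^o) => e e0; have e20 : 0 < e / 2 by rewrite divr_gt0.
apply: filterS2 (ar' _ e20) (ai' _ e20) => t dr di.
rewrite sub0r normrN /= ger0_norm ?fine_ge0 ?Lnorm_ge0//.
have le2 := le_trans (bound t) (leeD dr di).
rewrite -lee_fin fineK.
  by rewrite [in leRHS](splitr e) EFinD.
rewrite ge0_fin_numE ?Lnorm_ge0//; apply: le_lt_trans le2 _.
by rewrite -EFinD ltry.
Qed.

End averaging_consequences.

(** * The translation flow *)

Section the_flow.
Context {R : realType}.
Notation Xt := (@path_space R).
Notation law := (@path_law R).
Notation flow := (@flow R).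
Notation E := (R * R)%type.

Lemma le1_shift (t : R) (l : seq E) : all (fun e : E => e.2 <= 1) l ->
  all (fun e : E => e.2 <= 1) [seq (e.1 + t, e.2) | e <- l].
Proof. by rewrite all_map. Qed.

Lemma avoid_shift (t : R) (l : seq E) :
  avoid [seq (e.1 + t, e.2) | e <- l] = avoid l :> R.
Proof. by rewrite /avoid balls_shift dens_shift//; case: (finm_balls l). Qed.

Lemma law_flow_above (t : R) l : all (fun e : E => e.2 <= 1) l ->
  law (flow t @^-1` above l) = law (above l).
Proof.
move=> l1; transitivity (law (above [seq (e.1 + t, e.2) | e <- l])).
  by congr (law _); exact: flow_above.
by rewrite (path_law_above (le1_shift t l1)) (path_law_above l1) avoid_shift.
Qed.

Lemma law_return_above (t : R) l l' : all (fun e : E => e.2 <= 1) l ->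
  all (fun e : E => e.2 <= 1) l' ->
  law (flow t @^-1` above l `&` above l') =
  (expR (- dens (translate (- t) (balls l) `|` balls l')))%:E.
Proof.
move=> l1 l1'; rewrite -balls_shift -balls_cat -path_law_above; last first.
  by rewrite all_cat le1_shift.
by congr (law _); rewrite above_cat; congr (_ `&` _); exact: flow_above.
Qed.

Let measurable_flow1 (t : R) : measurable_fun setT (flow t).
Proof. exact: (measurableT_comp flow_jointly_measurable (measurable_pair1 t)). Qed.

(** Density is translation invariant and the void events determine the law. *)
Lemma law_flow (t : R) (A : set Xt) : measurable A -> law (flow t @^-1` A) = law A.
Proof.
move=> mA; have mf := measurable_flow1 t.
have := @measure_unique _ R Xt above_sets (fun=> setT) measurable_path_spaceE
  above_sets_setI _ _ (pushforward law (flow t)) law _ _ A mA.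
rewrite /pushforward; apply => //.
- by move=> _; exists [::] => //; exact: above_nil.
- by apply/seteqP; split => // x _; exists 0%N.
- by move=> _ [l l1 <-]; exact: law_flow_above.
- by move=> k; exact: (le_lt_trans (probability_le1 law (@measurableT _ Xt)) (ltry 1)).
Qed.

Lemma law_mp_flow : mp_flow law flow.
Proof.
split.
- exact: flow_zero.
- by move=> s t x; exact: flow_add.
- exact: flow_jointly_measurable.
- exact: law_flow.
Qed.

Lemma recurrentN (K t : R) : recurrent K (- t) -> recurrent K t.
Proof. by rewrite /recurrent normrN. Qed.

(** The recurrence times are symmetric, hence the sign of s is irrelevant. *)
Lemma law_above_indep (l : seq E) : all (fun e : E => e.2 <= 1) l ->
  exists2 K : R, 0 <= K & forall s, ~ recurrent K s ->
    law (flow s @^-1` above l `&` above l) = (law (above l) * law (above l))%E.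
Proof.
move=> l1; have [K K0 lK] := balls_bounded l; exists (K + K); first exact: addr_ge0.
move=> s ns; rewrite (law_return_above s l1 l1) (path_law_above l1).
rewrite -EFinM -expRD; congr (expR _)%:E.
rewrite setUC (@dens_indep _ K)//; try exact: finm_balls.
  by rewrite opprD.
by move=> /recurrentN.
Qed.

Lemma law_averaging (A : set Xt) : measurable A -> averaging law flow (\1_A).
Proof.
move: A; apply: (averaging_generated law_mp_flow measurable_path_spaceE above_sets_setI).
move=> _ [l l1 <-]; have [K K0 lK] := law_above_indep l1.
apply: (averaging_indep law_mp_flow (measurable_above l) (measurable_recurrent K)) => //.
exact: thin_recurrent.
Qed.

Lemma law_almost_mixing : almost_mixing law flow.
Proof. exact: averaging_almost_mixing law_mp_flow law_averaging. Qed.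

Definition gap_event : set Xt := above [:: (0, 2^-1)].

Let half_le1 : all (fun e : E => e.2 <= 1) [:: (0 : R, 2^-1 : R)].
Proof. by rewrite /= andbT invf_le1// ler1n. Qed.

Lemma law_gap_event : law gap_event = (expR (- 1))%:E.
Proof. by rewrite path_law_above// /avoid/= setU0 -/unit_ball dens_unit_ball. Qed.

Lemma law_gap_event_return n :
  ((expR (- (3 / 2)))%:E <= law (flow (gap n) @^-1` gap_event `&` gap_event))%E.
Proof.
rewrite (law_return_above _ half_le1 half_le1) lee_fin ler_expR lerN2 /= setU0 setUC.
exact: dens_recurrence.
Qed.

(** For the event that the ball of radius 1/2 is missed, the correlations along the gaps
    are at least exp (- 3/2), larger than the square exp (- 2) of its probability. *)
Lemma law_not_mixing : ~ mixing law flow.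
Proof.
pose f (x : Xt) : R[i] := Complex (\1_gap_event x) 0.
have mE : measurable gap_event by exact: measurable_above.
have m1 : measurable_fun setT (\1_gap_event : Xt -> R) by exact: measurable_indic.
have If (A : set Xt) : measurable A -> (\int[law]_x (\1_A x : R))%R = fine (law A).
  by move=> mA; rewrite /Rintegral integral_indic// setIT.
have fL2 : in_Lp law 2%:E f.
  split => //; rewrite /Lpnorm unlock; apply: poweR_lty.
  rewrite (_ : (\int[law]_x _)%E = law gap_event); first by rewrite law_gap_event ltry.
  rewrite -[X in _ = law X]setIT -integral_indic//; apply: eq_integral => x _.
  rewrite /= /f indicE; case: (x \in _) => /=.
    by rewrite expr1n expr0n/= addr0 sqrtr1 normr1 powR1.
  by rewrite expr0n/= addr0 sqrtr0 normr0 powR0// pnatr_eq0.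
have I0 : (\int[law]_x (0 : R))%R = 0.
  by rewrite /Rintegral integral0_eq.
move=> /(_ f f fL2 fL2).
pose q : R := expR (- 1).
have cf : cintegral law f = Complex q 0.
  by rewrite /cintegral /f/= I0 If// law_gap_event.
have cfc : cintegral law (fun x => conjc (f x)) = Complex q 0.
  by rewrite /cintegral /f/= oppr0 I0 If// law_gap_event.
rewrite cf cfc; have -> : Complex q 0 * Complex q 0 = Complex (q * q) 0 :> R[i].
  by apply/eqP; rewrite eq_complex/= !mulr0 mul0r subr0 addr0 !eqxx.
pose d : R := expR (- (3 / 2)) - q * q.
have d0 : 0 < d by rewrite subr_gt0 -expRD ltr_expR; lra.
have d0C : 0 < Complex d 0 :> R[i] by rewrite ltcE/= eqxx.
move=> /(@cvgrPdist_lt _ (R[i]^o)) /(_ _ d0C) [M [_ Mu]].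
have [n Mn] : exists n, M < gap n.
  exists (Num.bound `|M|); apply: le_lt_trans (ler_norm M) _.
  apply: lt_le_trans (archi_boundP (normr_ge0 M)) _; rewrite /gap ler_nat.
  by apply: leq_trans (leq_pmulr _ (fact_gt0 _)); rewrite ltnW.
have := Mu _ Mn; set z := inner _ _ _ => zd.
set A := flow (gap n) @^-1` gap_event `&` gap_event.
have mA : measurable A.
  apply: measurableI => //.
  by have := measurable_flow1 (gap n) measurableT mE; rewrite setTI.
have rz : complex.Re z = fine (law A).
  rewrite -If// /z /inner /cintegral /=; apply: eq_Rintegral => x _.
  by rewrite /A indicI /= mul0r subr0.
have := le_lt_trans (normc_ge_Re (Complex (q * q) 0 - z)) zd.
have Re_sub (w : R[i]) : complex.Re (Complex (q * q) 0 - w) = q * q - complex.Re w.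
  by case: w.
rewrite ltcR Re_sub rz => h.
have := law_gap_event_return n; rewrite -/A.
rewrite -[X in (_ <= X)%E]fineK; last exact: fin_num_measure.
rewrite lee_fin => h2; move: h; rewrite ltr_norml => /andP[h _].
by rewrite /d in h; lra.
Qed.

End the_flow.

Theorem theorem3p2 (R : realType) :
  exists (d : measure_display) (X : measurableType d)
         (mu : probability X R) (T : R -> X -> X),
    standard_borel R X /\ mp_flow mu T /\ almost_mixing mu T /\ ~ mixing mu T.
Proof.
exists _, path_space, path_law, flow; split; first exact: standard_borel_path_space.
split; first exact: law_mp_flow.
by split; [exact: law_almost_mixing|exact: law_not_mixing].
Qed.
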